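(* Let $(\xi,J)$ be a Markov additive process with $\xi$ nondecreasing, with Bernstein matrix $\mathbf\Phi$, whose Markov chain of types (rate matrix $\mathbf\Lambda$) is irreducible and whose position component is not a.s. constant. Assume that there is no killing ($k^{(i)}=0$ for all $i\in[K]$) and that $\underline p<0$. Let $I_\xi=\int_0^\infty e^{-\xi_t}dt$ and let $\mathbf N(p)$ be the column vector with entries $(\mathbf N(p))_i=\mathbb E_i[I_\xi^p]$, $i\in[K]$. (i) We have $$\mathbf N(-1)=\mathbf\Phi'(0)\mathbf 1-\mathbf\Lambda\mathbf N'(0),$$ where $\mathbf\Phi'(0)$ and $\mathbf N'(0)$, the derivatives of $\mathbf\Phi$ and $\mathbf N$ at $0$, are given by $(\mathbf\Phi'(0))_{i,j}=\mathbb E_i[\xi_1\mathbf 1_{\{J_1=j\}}]$ and $(\mathbf N'(0))_i=\mathbb E_i[\ln I_\xi]$ for all $i,j\in[K]$. (ii) For every integer $k<0$ with $k>\underline p-1$, $$\mathbf N(k)=\frac{(-1)^{k+1}}{(|k|-1)!}\left(\prod_{l=k+1}^{-1}\mathbf\Phi(l)\right)\mathbf N(-1),$$ where the product is ordered as $\mathbf\Phi(k+1)\mathbf\Phi(k+2)\cdots\mathbf\Phi(-1)$.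
   Context: Fix $K\in\mathbb N$, $[K]=\{1,\dots,K\}$. A Markov additive process (MAP) is a Markov process $((\xi_t,J_t),t\ge0)$ on $\mathbb R\times[K]\cup\{(+\infty,0)\}$, with law $\mathbb P_{(x,i)}$ when started at $(x,i)$, such that for all $t$ and $(x,i)$, under $\mathbb P_{(x,i)}$, conditionally on $(\xi_u,J_u)_{u\le t}$ and $\xi_t<\infty$, the process $((\xi_{t+s}-\xi_t,J_{t+s}),s\ge0)$ has law $\mathbb P_{(0,J_t)}$, and $(+\infty,0)$ is absorbing. $\mathbb P_i=\mathbb P_{(0,i)}$, with expectation $\mathbb E_i$. A MAP with $\xi$ nondecreasing is characterised by: the transition rate matrix $\mathbf\Lambda=(\lambda_{i,j})$ of the chain $J$ (before killing); probability distributions $B_{i,j}$ on $[0,\infty)$ (law of the jump of $\xi$ when $J$ jumps from $i$ to $j$, $B_{i,i}=\delta_0$), with $\widehat B_{i,j}(p)=\int_0^\infty e^{-px}B_{i,j}(dx)$; and triplets $(k^{(i)},c^{(i)},\Pi^{(i)})$ (killing rate, drift, L\'evy measure with $\int_{(0,\infty)}(1\wedge x)\Pi^{(i)}(dx)<\infty$) of the subordinator followed by $\xi$ while $J=i$, with Laplace exponent $\psi_i(p)=k^{(i)}+c^{(i)}p+\int_0^\infty(1-e^{-px})\Pi^{(i)}(dx)$. The Bernstein matrix is $\mathbf\Phi(p)=\mathrm{diag}(\psi_i(p))_{i\in[K]}-\big(\lambda_{i,j}\widehat B_{i,j}(p)\big)_{i,j\in[K]}$, defined (and analytic) for $p>\underline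 p$, where $$\underline p=\inf\Big\{p\in\mathbb R:\ \int_0^\infty(e^{-px}-1)\Pi^{(i)}(dx)<\infty\ \text{for all } i,\ \lambda_{i,j}\int_0^\infty e^{-px}B_{i,j}(dx)<\infty\ \text{for all } i,j\Big\};$$ for $p>\underline p$, $\mathbb E_i[e^{-p\xi_t}\mathbf 1_{\{J_t=j\}}]=(e^{-t\mathbf\Phi(p)})_{i,j}$. $\mathbf 1$ is the column vector with all entries $1$.
   Formalization: Φ'(0) is the true derivative; the formula (Φ'(0))_{ij}=E_i[ξ_1 1_{J_1=j}], false in general for K≥2, is replaced by Φ'(0)_{ij}=lim_{t→0+} E_i[ξ_t 1_{J_t=j}]/t and E_i[ξ_1 1_{J_1=j}]=∫_0^1 (e^{sΛ}Φ'(0)e^{(1-s)Λ})_{ij} ds. *)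

(* Defs.v *)
From HB Require Import structures.
From mathcomp Require Import all_boot all_order all_algebra.
From mathcomp Require Import all_classical all_reals all_analysis.

Set Implicit Arguments.
Unset Strict Implicit.
Unset Printing Implicit Defensive.

Import Order.TTheory GRing.Theory Num.Theory.
Import numFieldNormedType.Exports.

Local Open Scope classical_set_scope.
Local Open Scope ring_scope.

(* [Some (x, i)] is the point (x, i) of R x [K]; [None] is the cemetery
   point (+oo, 0). *)
Definition state (R : realType) (K : nat) : Type := option (R * 'I_K).

Section MarkovAdditiveProcess.
Context (R : realType) (K : nat) (d : measure_display) (T : measurableType d).
Implicit Types (X : R -> T -> state R K) (P : R -> 'I_K -> probability T R).

Definition position_at X (t : R) (w : T) : \bar R :=
  if X t w is Some (x, _) then x%:E else +oo%E.

Definition type_at X (t : R) (w : T) : option 'I_K := omap snd (X t w).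

Definition cell (B : set R) (j : 'I_K) : set (state R K) :=
  [set s | exists2 x, B x & s = Some (x, j)].

(* Paths are functions on R, but only their values at nonnegative times are
   ever observed; [path_events] is the product sigma-algebra on
   [state R K]^[0, +oo[. *)
Definition path_events : set (set (R -> state R K)) :=
  <<s [set C | exists (u : R) (B : set R) j, [/\ 0 <= u, measurable B &
         C = [set f : R -> state R K | cell B j (f u)]] ] >>.

Definition past X (t : R) : set (set T) :=
  <<s [set A | exists (u : R) (B : set R) j, [/\ 0 <= u <= t, measurable B &
         A = X u @^-1` cell B j] ] >>.

(* ((xi_(t+s) - xi_t, J_(t+s)), s >= 0), sent to the cemetery when killed *)
Definition shifted X (t : R) (w : T) (s : R) : state R K :=
  match X t w, X (t + s) w with
  | Some (x, _), Some (y, j) => Some (y - x, j)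
  | _, _ => None
  end.

Record is_MAP (P : R -> 'I_K -> probability T R) (X : R -> T -> state R K) :
    Prop := {
  map_measurable : forall (t : R) (B : set R) j, 0 <= t -> measurable B ->
    measurable (X t @^-1` cell B j) ;
  map_right_continuous : forall (t : R) w, 0 <= t ->
    position_at X s w @[s --> t^'+] --> position_at X t w /\
    (\forall s \near t^'+, type_at X s w = type_at X t w) ;
  map_start : forall x i, P x i (X 0 @^-1` [set Some (x, i)]) = 1%E ;
  (* on {J_t = j}, which is contained in {xi_t < +oo}, the shifted path is
     independent of the past and has law P_(0, j) *)
  map_markov_additive : forall x i (t : R) j A C, 0 <= t ->
    past X t A -> path_events C ->
    P x i (A `&` [set w | type_at X t w = Some j] `&`
           [set w | C (shifted X t w)]) =
    (P x i (A `&` [set w | type_at X t w = Some j]) *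
     P 0%R j [set w | C (X ^~ w)])%E ;
  map_absorbing : forall x i, {ae P x i, forall w, forall s t : R,
    0 <= s <= t -> X s w = None -> X t w = None} }.

Definition nondecreasing_position P X : Prop :=
  forall x i, {ae P x i, forall w, forall s t : R,
    0 <= s <= t -> (position_at X s w <= position_at X t w)%E}.

Definition constant_position P X : Prop :=
  forall x i, {ae P x i, forall w, forall t : R,
    0 <= t -> position_at X t w = position_at X 0 w}.

(* I_xi, with e^(-oo) = 0 *)
Definition exp_functional X (w : T) : \bar R :=
  (\int[lebesgue_measure]_(t in `[0%R, +oo[) expeR (- position_at X t w))%E.

(* E_i[I_xi^p]. The power is exp (p ln I), hence 0^p = +oo and (+oo)^p = 0 for
   p < 0 ([poweR] has 0^p = 0 and (+oo)^p = +oo instead). *)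
Definition moment P X (p : R) (i : 'I_K) : \bar R :=
  (\int[P 0%R i]_w expeR (p%:E * lne (exp_functional X w)))%E.

Definition Nvec P X (p : R) : 'cV[R]_K := \col_i fine (moment P X p i).

End MarkovAdditiveProcess.

Section Characteristics.
Context (R : realType) (K : nat).

Record characteristics : Type := Characteristics {
  rate : 'M[R]_K ;
  jump_law : 'I_K -> 'I_K -> probability (measurableTypeR R) R ;
  killing : 'I_K -> R ;
  drift : 'I_K -> R ;
  levy : 'I_K -> {measure set (measurableTypeR R) -> \bar R} }.

Record admissible (c : characteristics) : Prop := {
  rate_ge0 : forall i j, i != j -> 0 <= rate c i j ;
  rate_row : forall i, \sum_j rate c i j = 0 ;
  jump_law_ge0 : forall i j, jump_law c i j `[0, +oo[%classic = 1%E ;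
  jump_law_diag : forall i (B : set R), measurable B ->
    jump_law c i i B = \d_(0 : R) B ;
  killing_ge0 : forall i, 0 <= killing c i ;
  drift_ge0 : forall i, 0 <= drift c i ;
  levy_gt0 : forall i, levy c i `]-oo, 0]%classic = 0%E ;
  levy_integrable : forall i,
    (\int[levy c i]_(x in `]0%R, +oo[) (Num.min 1 x)%:E < +oo)%E }.

Definition irreducible_rate (L : 'M[R]_K) : Prop :=
  forall i j, connect [rel a b : 'I_K | 0 < L a b] i j.

Definition psi (c : characteristics) (i : 'I_K) (p : R) : R :=
  killing c i + drift c i * p +
  Rintegral (levy c i) `]0, +oo[%classic (fun x : R => 1 - expR (- (p * x))).

Definition jump_laplace (c : characteristics) (i j : 'I_K) (p : R) : R :=
  Rintegral (jump_law c i j) `[0, +oo[%classic (fun x : R => expR (- (p * x))).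

Definition Phi (c : characteristics) (p : R) : 'M[R]_K :=
  diag_mx (\row_i psi c i p) -
  \matrix_(i, j) (rate c i j * jump_laplace c i j p).

Definition underline_p (c : characteristics) : \bar R :=
  ereal_inf [set p%:E | p in [set p : R |
    (forall i, \int[levy c i]_(x in `]0%R, +oo[)
                 (expR (- (p * x)) - 1)%:E < +oo)%E /\
    (forall i j, (rate c i j)%:E *
       \int[jump_law c i j]_(x in `[0%R, +oo[) (expR (- (p * x)))%:E
         < +oo)%E]].

Definition expmx (A : 'M[R]_K) : 'M[R]_K :=
  \matrix_(i, j) limn (series (fun n => (n`!)%:R^-1 * (A ^+ n) i j)).

End Characteristics.

(* The law of a MAP with nondecreasing position is tied to its characteristics
   through its Bernstein matrix; this determines the rates, the jump laws along
   positive rates and the triplets. *)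
Definition has_characteristics (R : realType) (K : nat)
    (d : measure_display) (T : measurableType d)
    (P : R -> 'I_K -> probability T R) (X : R -> T -> state R K)
    (c : characteristics R K) : Prop :=
  admissible c /\
  forall (p t : R) (i j : 'I_K), (underline_p c < p%:E)%E -> 0 <= t ->
    (\int[P 0%R i]_(w in [set w | type_at X t w = Some j])
        expeR (- (p%:E * position_at X t w)) =
     (expmx (- (t *: Phi c p)) i j)%:E)%E.

(* Main.v *)
Require Import Defs.
From HB Require Import structures.
From mathcomp Require Import all_boot all_order all_algebra.
From mathcomp Require Import all_classical all_reals all_analysis.
From mathcomp Require Import measurable_realfun.
From mathcomp Require Import ring lra.

Import Order.TTheory GRing.Theory Num.Theory.
Import numFieldNormedType.Exports.

(** Put A_t = int_t^oo e^-xi_s ds, so that A_0 = I_xi. By the Markov additive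
    property A_t = e^-xi_t I', where on {J_t = j} the variable I' is independent
    of the past and has the law of I_xi under P_j. For underline_p < p < 0 this
    gives E_i[A_t^p] = (e^(-t Phi(p)) N(p))_i. The derivative of the right-hand
    side at t = 0 is -(Phi(p) N(p))_i; since d/dt A_t^p = -p A_t^(p-1) e^-xi_t,
    that of the left-hand side should be -p N(p-1)_i. Hence the relation
    Phi(p) N(p) = p N(p-1) for underline_p < p < 0 ([mom_recurrence]). Iterating
    it from p = -1 downwards gives part (ii) ([mom_negS]). As Phi(0) N(0) is
    -Lambda 1 = 0, dividing it by p and letting p increase to 0 gives part (i)
    ([mom_minus1]): the derivative of Phi N at 0 is Phi'(0) 1 - Lambda N'(0).

    The finiteness of N(p-1) is part of what has to be shown, so the two
    derivatives are compared through two inequalities. As a |-> a^p is convex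
    and A_0 - A_t >= t e^-xi_t, Fatou's lemma for t decreasing to 0 gives
    -p N(p-1) <= -Phi(p) N(p), hence finiteness ([mom_recurrence_le]).
    Conversely the increment A_t^p - A_0^p is bounded, up to an error that
    vanishes with the mesh, by Riemann sums of the integral over [0, t] of
    -p A_s^(p-1) e^-xi_s, whose terms have expectation
    (e^(-s Phi(p)) N(p-1))_i, again by the Markov additive property; this is
    close to N(p-1)_i for small s.

    The a priori bounds are as follows. For p < 0, I_xi >= e^-xi_1 because xi is
    nondecreasing, so N(p) is bounded by the row sums of e^(-Phi(p))
    ([mom_neg_fin]). For p = 1, the position moves with positive probability
    from some type, and irreducibility propagates this to all types: over a
    long enough period E_i[e^-xi] <= rho < 1 for every i, and E_i[I_xi] is
    dominated by a geometric series ([uniform_contraction],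
    [mean_path_functional]). N is then finite on an interval around 0, and
    differentiable there with N'(0)_i = E_i[ln I_xi], by differentiation under
    the integral sign ([is_derive_mgf]).

    The mean positions E_i[xi_t; J_t = j] are minus the derivative at p = 0 of
    the entries of e^(-t Phi(p)). For t decreasing to 0 they are Phi'(0)_ij t +
    o(t), because the expansion e^(tA) - e^(tB) = t(A - B) + o(t) is uniform
    relatively to the size of A - B ([expmxB_le]). At t = 1 the derivative of
    the matrix exponential is given by Duhamel's formula
    ([cvg_expmx_duhamel]).

    The Markov additive property concerns events of the product
    sigma-algebra, with respect to which the integral I_xi is not measurable as
    a functional of the path. On nondecreasing positions it coincides with a
    supremum of countably many Riemann sums, which is measurable
    ([integral_riemann_sup], [measurable_path_functional]), and everything is
    computed with this version. *)

Set Implicit Arguments.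
Unset Strict Implicit.
Unset Printing Implicit Defensive.

Local Open Scope classical_set_scope.
Local Open Scope ring_scope.

(** * The matrix exponential *)

Lemma cvg_sum_real (R : realType) (I S : Type) (F : set_system S) (r : seq I)
    (f : I -> S -> R) (a : I -> R) : Filter F ->
  (forall i, f i x @[x --> F] --> a i) ->
  (\sum_(i <- r) f i x) @[x --> F] --> \sum_(i <- r) a i.
Proof. by move=> FF fa; apply: cvg_big => //; exact: add_continuous. Qed.

Section MatrixExponential.
Context (R : realType) (K : nat).
Implicit Types (A B : 'M[R]_K).

Definition row_bound A (b : R) := forall i, \sum_k `|A i k| <= b.

Lemma row_bound_ex A : exists2 b : R, 0 <= b & row_bound A b.
Proof.
exists (\sum_i \sum_k `|A i k|).
  by apply: sumr_ge0 => i _; apply: sumr_ge0.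
move=> i; rewrite [leRHS](bigD1 i)//= lerDl.
by apply: sumr_ge0 => j _; apply: sumr_ge0.
Qed.

Lemma row_bound_entry A b i j : row_bound A b -> `|A i j| <= b.
Proof.
move=> /(_ i); apply: le_trans; rewrite (bigD1 j)//= lerDl.
by apply: sumr_ge0.
Qed.

Lemma row_bound_mul A B a b : 0 <= b -> row_bound A a -> (forall i j, `|B i j| <= b) ->
  forall i j, `|(A *m B) i j| <= a * b.
Proof.
move=> b0 Aa Bb i j; rewrite mxE; apply: (le_trans (ler_norm_sum _ _ _)).
apply: (@le_trans _ _ (\sum_k `|A i k| * b)).
  by apply: ler_sum => k _; rewrite normrM ler_wpM2l.
by rewrite -mulr_suml ler_wpM2r.
Qed.

Lemma row_bound_exp A b : 0 <= b -> row_bound A b ->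
  forall n i j, `|(A ^+ n) i j| <= b ^+ n.
Proof.
move=> b0 Ab; elim=> [|n ih] i j.
  by rewrite !expr0 mxE; case: eqP => _; rewrite ?normr1 ?normr0.
by rewrite !exprS; apply: row_bound_mul => //; exact: exprn_ge0.
Qed.

(** Coefficients of the power series of [A ^+ m *m expmx (t *: A)] in [t]: formal
    differentiation raises [m] by one, so that the family is closed under it. *)
Definition expmx_coeff A i j m (n : nat) : R := (n`!)%:R^-1 * (A ^+ (n + m)) i j.

Lemma expmx_coeff_diffs A i j m :
  pseries_diffs (expmx_coeff A i j m) = expmx_coeff A i j m.+1.
Proof.
apply/funext => n; rewrite /pseries_diffs /expmx_coeff factS natrM invfM.
by rewrite mulrA mulVKf ?pnatr_eq0// addnS addSn.
Qed.

(** The coefficients are dominated by those of [b ^+ m * expR (b * `|t|)], for a bound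
    [b] on the row sums of [A]. *)
Lemma cvg_expmx_coeff A i j m t : cvgn (pseries (expmx_coeff A i j m) t).
Proof.
have [b b0 Ab] := row_bound_ex A.
apply: normed_cvg.
have H : cvgn (series (fun n => b ^+ m * exp_coeff (b * `|t|) n)).
  by apply: is_cvg_seriesZ; exact: is_cvg_series_exp_coeff.
apply: series_le_cvg H => n /=; first by [].
  by rewrite /exp_coeff /= !mulr_ge0 ?exprn_ge0 ?mulr_ge0// invr_ge0 ler0n.
rewrite /expmx_coeff /exp_coeff /= !normrM normfV normr_nat normrX.
rewrite exprMn.
have -> : b ^+ m * (b ^+ n * `|t| ^+ n / n`!%:R) =
    n`!%:R^-1 * (b ^+ (n + m)) * `|t| ^+ n by rewrite exprD; ring.
by rewrite ler_wpM2r ?exprn_ge0// ler_wpM2l ?invr_ge0//; exact: row_bound_exp.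
Qed.

Lemma scaler_mx_exp (t : R) A n : (t *: A) ^+ n = t ^+ n *: A ^+ n.
Proof.
elim: n => [|n ih]; first by rewrite !expr0 scale1r.
by rewrite !exprS ih -[_ * _]/(_ *m _) -scalemxAl -scalemxAr scalerA.
Qed.

Lemma expmx_pseries A i j t :
  expmx (t *: A) i j = limn (pseries (expmx_coeff A i j 0) t).
Proof.
rewrite mxE /pseries; congr (limn (series _)); apply/funext => n.
by rewrite scaler_mx_exp mxE /expmx_coeff /= addn0; ring.
Qed.

Lemma lim_expmx_coeffS A i j t :
  limn (pseries (expmx_coeff A i j 1) t) = (A *m expmx (t *: A)) i j.
Proof.
rewrite mxE; under eq_bigr do rewrite expmx_pseries.
apply/cvg_lim => //.
have -> : pseries (expmx_coeff A i j 1) t =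
    fun n => \sum_k A i k * pseries (expmx_coeff A k j 0) t n.
  apply/funext => n; rewrite /pseries /series /=.
  under [RHS]eq_bigr do rewrite mulr_sumr.
  rewrite exchange_big /=; apply: eq_bigr => l _.
  rewrite /expmx_coeff addn1 exprS mxE mulr_sumr mulr_suml.
  by apply: eq_bigr => k _; rewrite addn0; ring.
apply: cvg_sum_real => k; apply: cvgM; first exact: cvg_cst.
exact: cvg_expmx_coeff.
Qed.

Lemma lim_expmx_coeffSr A i j t :
  limn (pseries (expmx_coeff A i j 1) t) = (expmx (t *: A) *m A) i j.
Proof.
rewrite mxE; under eq_bigr do rewrite expmx_pseries mulrC.
apply/cvg_lim => //.
have -> : pseries (expmx_coeff A i j 1) t =
    fun n => \sum_k A k j * pseries (expmx_coeff A i k 0) t n.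
  apply/funext => n; rewrite /pseries /series /=.
  under [RHS]eq_bigr do rewrite mulr_sumr.
  rewrite exchange_big /=; apply: eq_bigr => l _.
  rewrite /expmx_coeff addn1 exprSr mxE mulr_sumr mulr_suml.
  by apply: eq_bigr => k _; rewrite addn0; ring.
apply: cvg_sum_real => k; apply: cvgM; first exact: cvg_cst.
exact: cvg_expmx_coeff.
Qed.

Lemma is_derive_expmx_coeff A i j (t : R) :
  is_derive t 1 (fun s => expmx (s *: A) i j)
    (limn (pseries (expmx_coeff A i j 1) t)).
Proof.
under eq_fun do rewrite expmx_pseries.
rewrite -expmx_coeff_diffs; apply: (@pseries_snd_diffs _ _ (`|t| + 1)).
- exact: cvg_expmx_coeff.
- by rewrite expmx_coeff_diffs; exact: cvg_expmx_coeff.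
- by rewrite !expmx_coeff_diffs; exact: cvg_expmx_coeff.
- by rewrite [ltRHS]ger0_norm// ltrDl.
Qed.

Lemma is_derive_expmx A i j (t : R) :
  is_derive t 1 (fun s => expmx (s *: A) i j) ((A *m expmx (t *: A)) i j).
Proof. by rewrite -lim_expmx_coeffS; exact: is_derive_expmx_coeff. Qed.

Lemma is_derive_expmxr A i j (t : R) :
  is_derive t 1 (fun s => expmx (s *: A) i j) ((expmx (t *: A) *m A) i j).
Proof. by rewrite -lim_expmx_coeffSr; exact: is_derive_expmx_coeff. Qed.

Lemma expmx0 A : expmx (0 *: A) = 1%:M.
Proof.
apply/matrixP => i j; rewrite expmx_pseries; apply/cvg_lim => //.
apply: cvg_near_cst; exists 1%N => // -[|n] //= _.
rewrite /pseries /series /= big_nat_recl//= big1 ?addr0.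
  by rewrite /expmx_coeff fact0 invr1 addn0 !expr0 mulr1 mul1r.
by move=> k _; rewrite expr0n /= mulr0.
Qed.

Lemma continuous_expmx A i j : continuous (fun s : R => expmx (s *: A) i j).
Proof.
move=> t; apply/differentiable_continuous/derivable1_diffP.
by have [] := is_derive_expmx A i j t.
Qed.

Lemma is_derive_mxmul (F G : R -> 'M[R]_K) (F' G' : 'M[R]_K) (t : R) :
  (forall i j, is_derive t 1 (fun s => F s i j) (F' i j)) ->
  (forall i j, is_derive t 1 (fun s => G s i j) (G' i j)) ->
  forall i j, is_derive t 1 (fun s => (F s *m G s) i j)
    ((F' *m G t + F t *m G') i j).
Proof.
move=> dF dG i j.
have -> : (fun s => (F s *m G s) i j) =
    \sum_(k < K) (fun s => F s i k * G s k j).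
  by apply/funext => s; rewrite mxE fct_sumE.
have -> : (F' *m G t + F t *m G') i j =
    \sum_(k < K) (F t i k * G' k j + G t k j * F' i k).
  rewrite !mxE -big_split /=; apply: eq_bigr => k _; ring.
apply: is_derive_sum => k.
have := @is_deriveM _ _ _ _ t 1 _ _ (dF i k) (dG k j).
by [].
Qed.

(** The product [e^(sA) e^((c-s)A)] does not depend on [s], its derivative
    being zero. *)
Lemma expmxD A (s t : R) :
  expmx ((s + t) *: A) = expmx (s *: A) *m expmx (t *: A).
Proof.
apply/matrixP => i j.
pose h (u : R) : R := (expmx (u *: A) *m expmx ((s + t - u) *: A)) i j.
have dh (u : R) : is_derive u 1 h 0.
  have dG k l : is_derive u 1 (fun v => expmx ((s + t - v) *: A) k l)
      ((- (A *m expmx ((s + t - u) *: A))) k l).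
    have d1 : is_derive u 1 (fun v : R => s + t - v) (-1).
      have := is_deriveB (is_derive_cst (s + t) u (1 : R)) (is_derive_id u (1 : R)).
      by rewrite sub0r.
    have := @is_derive1_comp R (fun v : R => expmx (v *: A) k l)
      (fun v : R => s + t - v) u _ _ (is_derive_expmx A k l _) d1.
    rewrite mulrN1 => d2; rewrite [X in is_derive _ _ _ X]mxE; exact: d2.
  have := is_derive_mxmul (fun k l => is_derive_expmxr A k l u) dG i j.
  by rewrite mulmxN mulmxA subrr mxE.
have := is_derive_0_is_cst s 0 dh.
by rewrite /h expmx0 mul1mx subr0 addrC addKr => ->.
Qed.

End MatrixExponential.

(** * Comparison of two matrix exponentials *)

Section MatrixExponentialDiff.
Context (R : realType) (K : nat).
Implicit Types (A B : 'M[R]_K).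

Lemma expmx_cvg A i j (t : R) :
  pseries (expmx_coeff A i j 0) t n @[n --> \oo] --> expmx (t *: A) i j.
Proof. by rewrite expmx_pseries; exact: cvg_expmx_coeff. Qed.

(** Telescoping: a difference of powers contains the factor [A - B] once. *)
Lemma row_bound_expB A B b d : 0 <= b -> 0 <= d ->
  row_bound A b -> row_bound B b -> row_bound (A - B) d ->
  forall n i j, `|(A ^+ n.+1 - B ^+ n.+1) i j| <= n.+1%:R * b ^+ n * d.
Proof.
move=> b0 d0 Ab Bb ABd; elim=> [|n ih] i j.
  by rewrite !expr1 expr0 !mul1r; exact: row_bound_entry.
have -> : A ^+ n.+2 - B ^+ n.+2 =
    A *m (A ^+ n.+1 - B ^+ n.+1) + (A - B) *m B ^+ n.+1.
  by rewrite mulmxBr mulmxBl !exprS addrA subrK.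
rewrite mxE (le_trans (ler_normD _ _))//.
have -> : n.+2%:R * b ^+ n.+1 * d =
    b * (n.+1%:R * b ^+ n * d) + d * b ^+ n.+1.
  by rewrite exprS -(natr1 n.+1); ring.
apply: lerD.
  by apply: row_bound_mul => //; rewrite !mulr_ge0 ?exprn_ge0.
apply: row_bound_mul => //; first by rewrite exprn_ge0.
by move=> k l; exact: row_bound_exp.
Qed.

(** First-order expansion of [e^(tA) - e^(tB)], with a remainder that is
    proportional to the distance of [A] and [B]. *)
Lemma expmxB_le A B b d t : 0 <= b -> 0 <= d -> 0 <= t ->
  row_bound A b -> row_bound B b -> row_bound (A - B) d ->
  forall i j, `|expmx (t *: A) i j - expmx (t *: B) i j - t * (A - B) i j|
    <= d * t * (expR (t * b) - 1).
Proof.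
move=> b0 d0 t0 Ab Bb ABd i j.
pose u n := pseries (expmx_coeff A i j 0) t n - pseries (expmx_coeff B i j 0) t n
  - t * (A - B) i j.
pose v n := d * t * (series (exp_coeff (t * b)) n - 1).
have subE (M N : 'M[R]_K) : (M - N) i j = M i j - N i j by rewrite !mxE.
have uv n : `|u n.+2| <= v n.+1.
  elim: n => [|n ih].
    (* the terms of order 0 and 1 of the series cancel in [u] *)
    have -> : u 2%N = 0.
      rewrite /u /pseries /series /= !big_nat_recr//= !big_geq// /expmx_coeff.
      by rewrite !addn0 !expr0 !expr1 !mxE !fact0 (_ : 1`! = 1%N)// invr1; ring.
    rewrite normr0 /v /series /= big_nat_recr//= big_geq// /exp_coeff /= expr0.
    by rewrite fact0 divr1 add0r subrr mulr0.
  have -> : u n.+3 = u n.+2 + n.+2`!%:R^-1 * (A ^+ n.+2 - B ^+ n.+2) i j * t ^+ n.+2.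
    rewrite /u /pseries /series /= !(big_nat_recr n.+2)//= /expmx_coeff !addn0.
    by rewrite (subE (A ^+ n.+2)); ring.
  have -> : v n.+2 = v n.+1 + d * t * ((t * b) ^+ n.+1 / n.+1`!%:R).
    by rewrite /v /series /= (big_nat_recr n.+1)//= -addrAC mulrDr.
  rewrite (le_trans (ler_normD _ _))// lerD// 2!normrM normfV normr_nat normrX.
  rewrite (ger0_norm t0).
  have -> : d * t * ((t * b) ^+ n.+1 / n.+1`!%:R) =
      n.+2`!%:R^-1 * (n.+2%:R * b ^+ n.+1 * d) * t ^+ n.+2.
    rewrite [n.+2`!]factS natrM invfM exprMn (exprS t n.+1).
    have : (n.+2%:R : R) != 0 by rewrite pnatr_eq0.
    have : (n.+1`!%:R : R) != 0 by rewrite pnatr_eq0 -lt0n fact_gt0.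
    by move: (n.+2%:R : R) (n.+1`!%:R : R) (b ^+ n.+1) (t ^+ n.+1) => ? ? ? ? ? ?; field; apply/andP.
  rewrite ler_wpM2r ?exprn_ge0// ler_wpM2l ?invr_ge0//.
  exact: row_bound_expB.
have cu : u n.+2 @[n --> \oo] -->
    expmx (t *: A) i j - expmx (t *: B) i j - t * (A - B) i j.
  rewrite (cvg_shiftS (fun n => u n.+1)) (cvg_shiftS u).
  apply: cvgB; last exact: cvg_cst.
  by apply: cvgB; exact: expmx_cvg.
have cv : v n.+1 @[n --> \oo] --> d * t * (expR (t * b) - 1).
  rewrite (cvg_shiftS v); apply: cvgM; first exact: cvg_cst.
  apply: cvgB; last exact: cvg_cst.
  exact: is_cvg_series_exp_coeff.
apply: (ler_cvg_to (cvg_norm cu) cv).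
by near=> n; exact: uv.
Unshelve. all: by end_near. Qed.

End MatrixExponentialDiff.

(** * Duhamel's formula *)

Section Duhamel.
Context (R : realType) (K : nat).
Implicit Types (A B : 'M[R]_K).

(** Obtained by comparison with [expmx 0]. *)
Lemma expmx_bounded A b u i j : 0 <= b -> 0 <= u <= 1 -> row_bound A b ->
  `|expmx (u *: A) i j| <= 1 + b * expR b.
Proof.
move=> b0 /andP[u0 u1] Ab.
have r0 : row_bound (0 : 'M[R]_K) b.
  by move=> k; rewrite big1// => l _; rewrite mxE normr0.
have rA : row_bound (A - 0) b by rewrite subr0.
have := expmxB_le b0 b0 u0 Ab r0 rA i j.
have E0 : expmx (0 : 'M[R]_K) = 1%:M by rewrite -(expmx0 (0 : 'M[R]_K)) scale0r.
rewrite subr0 scaler0 E0.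
set e := expmx _ i j; set w := (1%:M : 'M[R]_K) i j => H.
have w1 : `|w| <= 1 by rewrite /w mxE; case: eqP => _; rewrite ?normr1 ?normr0.
have Aij : `|u * A i j| <= b.
  by rewrite normrM ger0_norm// (le_trans _ (row_bound_entry i j Ab))// ler_piMl.
have eb : b * u * (expR (u * b) - 1) <= b * (expR b - 1).
  apply: (@le_trans _ _ (b * u * (expR b - 1))).
    by rewrite ler_wpM2l ?mulr_ge0// lerD2r ler_expR ler_piMl.
  rewrite ler_wpM2r//; last by rewrite ler_piMr.
  by rewrite subr_ge0 -expR0 ler_expR.
have -> : e = (e - w - u * A i j) + (w + u * A i j) by ring.
apply: (le_trans (ler_normD _ _)).
apply: (le_trans (lerD (le_trans H eb) (ler_normD _ _))).
by move: w1 Aij; set x := `|w|; set y := `|_ * _|; lra.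
Qed.

Lemma continuous_mxmul (F G : R -> 'M[R]_K) :
  (forall i j, continuous (fun s => F s i j)) ->
  (forall i j, continuous (fun s => G s i j)) ->
  forall i j, continuous (fun s => (F s *m G s) i j).
Proof.
move=> cF cG i j s.
have -> : (fun s => (F s *m G s) i j) = fun s => \sum_k F s i k * G s k j.
  by apply/funext => u; rewrite mxE.
by apply: cvg_sum_real => k; apply: cvgM; [exact: cF|exact: cG].
Qed.

Lemma cvg_mxmul (F G : nat -> 'M[R]_K) (f g : 'M[R]_K) :
  (forall i j, F n i j @[n --> \oo] --> f i j) ->
  (forall i j, G n i j @[n --> \oo] --> g i j) ->
  forall i j, (F n *m G n) i j @[n --> \oo] --> (f *m g) i j.
Proof.
move=> cF cG i j.
have -> : (fun n => (F n *m G n) i j) = fun n => \sum_k F n i k * G n k j.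
  by apply/funext => u; rewrite mxE.
by rewrite mxE; apply: cvg_sum_real => k; apply: cvgM.
Qed.

Lemma is_derive_expmx_rev B i j (s : R) :
  is_derive s 1 (fun u => expmx ((1 - u) *: B) i j)
    ((- (B *m expmx ((1 - s) *: B))) i j).
Proof.
have d1 : is_derive s 1 (fun v : R => 1 - v) (-1).
  have := is_deriveB (is_derive_cst (1 : R) s (1 : R)) (is_derive_id s (1 : R)).
  by rewrite sub0r.
have := @is_derive1_comp R (fun v : R => expmx (v *: B) i j)
  (fun v : R => 1 - v) s _ _ (is_derive_expmx B i j _) d1.
by rewrite mulrN1 [(- (B *m _)) i j]mxE.
Qed.

Definition duhamel_integrand A Q B (s : R) : 'M[R]_K :=
  expmx (s *: A) *m Q *m expmx ((1 - s) *: B).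

Lemma continuous_duhamel_integrand A Q B i j :
  continuous (fun s => duhamel_integrand A Q B s i j).
Proof.
apply: continuous_mxmul => [k l|k l].
  apply: continuous_mxmul => [m n|m n]; first exact: continuous_expmx.
  by move=> s; exact: cvg_cst.
move=> s; apply/differentiable_continuous/derivable1_diffP.
by have [] := is_derive_expmx_rev B k l s.
Qed.

(** Duhamel's formula: the derivative of [s |-> e^(sA) e^((1-s)B)] is
    [e^(sA) (A - B) e^((1-s)B)]. *)
Lemma expmx_duhamel A B i j :
  (\int[lebesgue_measure]_(s in `[0%R, 1%R]) (duhamel_integrand A (A - B) B s i j)%:E =
   (expmx A i j - expmx B i j)%:E)%E.
Proof.
pose F s := (expmx (s *: A) *m expmx ((1 - s) *: B)) i j.
have dF (s : R) : is_derive s 1 F (duhamel_integrand A (A - B) B s i j).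
  have := is_derive_mxmul (fun k l => is_derive_expmxr A k l s)
    (fun k l => is_derive_expmx_rev B k l s) i j.
  rewrite (_ : expmx (s *: A) *m A *m _ + _ = duhamel_integrand A (A - B) B s)//.
  by rewrite /duhamel_integrand mulmxBr mulmxBl mulmxN !mulmxA.
have cF (s : R) : {for s, continuous F}.
  by apply/differentiable_continuous/derivable1_diffP; have [] := dF s.
rewrite (continuous_FTC2 (F := F) ltr01).
- by rewrite /F !scale1r subr0 subrr !expmx0 scale1r mulmx1 mul1mx -EFinB.
- by apply: continuous_subspaceT; exact: continuous_duhamel_integrand.
- split.
  + by move=> s _; have [] := dF s.
  + by apply: cvg_at_right_filter; exact: cF.
  + by apply: cvg_at_left_filter; exact: cF.
- by move=> s _; rewrite derive1E; have [_ ->] := dF s.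
Qed.

(** The derivative of the matrix exponential at [A] in the direction [Q], along
    sequences. Duhamel's formula writes the difference quotient as an integral
    over [0, 1] of uniformly bounded functions that converge pointwise. *)
Lemma cvg_expmx_duhamel A (An : nat -> 'M[R]_K) (Q : 'M[R]_K) :
  (forall i j, n.+1%:R * (An n i j - A i j) @[n --> \oo] --> Q i j) ->
  forall i j, n.+1%:R * (expmx (An n) i j - expmx A i j) @[n --> \oo] -->
    Rintegral lebesgue_measure `[0, 1]%classic (fun s => duhamel_integrand A Q A s i j).
Proof.
move=> cQ i j.
pose Qn n : 'M[R]_K := n.+1%:R *: (An n - A).
have QnE n k l : Qn n k l = n.+1%:R * (An n k l - A k l) by rewrite !mxE.
have {}cQ k l : Qn n k l @[n --> \oo] --> Q k l.
  by under eq_fun do rewrite QnE; exact: cQ.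
have [q q0 Hq] : exists2 q, 0 <= q & forall n, row_bound (Qn n) q.
  have bd (kl : 'I_K * 'I_K) : exists x : R, forall n, `|Qn n kl.1 kl.2| <= x.
    have /cvg_seq_bounded : cvgn (fun n => Qn n kl.1 kl.2).
      by apply/cvg_ex; exists (Q kl.1 kl.2).
    by move=> /pinfty_ex_gt0[x _ Hx]; exists x => n; exact: Hx.
  have [x Hx] := choice bd.
  exists (\sum_k \sum_l `|x (k, l)|).
    by apply: sumr_ge0 => k _; apply: sumr_ge0.
  move=> n k; apply: (@le_trans _ _ (\sum_l `|x (k, l)|)).
    apply: ler_sum => l _; apply: (le_trans (Hx (k, l) n)); exact: ler_norm.
  rewrite [leRHS](bigD1 k)//= lerDl.
  by apply: sumr_ge0 => m _; apply: sumr_ge0.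
(* [b] bounds the row sums of [A] and of all the [An n] *)
have [a a0 Ha] := row_bound_ex A.
have n1 n : 0 <= (n.+1%:R^-1 : R) <= 1 by rewrite invr_ge0 ler0n/= invf_le1// ler1n.
have AnE n : An n = A + n.+1%:R^-1 *: Qn n.
  by rewrite scalerA mulVf ?pnatr_eq0// scale1r addrC subrK.
pose b := a + q; have b0 : 0 <= b by exact: addr_ge0.
have Hdiff n : row_bound (An n - A) (n.+1%:R^-1 * q).
  move=> k; rewrite AnE addrC addKr.
  under eq_bigr do rewrite mxE normrM ger0_norm ?invr_ge0//.
  by rewrite -mulr_sumr ler_wpM2l ?invr_ge0//; exact: Hq.
have HAn n : row_bound (An n) b.
  move=> k; apply: (@le_trans _ _ (\sum_l (`|A k l| + `|(An n - A) k l|))).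
    apply: ler_sum => l _; apply: le_trans (ler_normD _ _).
    have -> : A k l + (An n - A) k l = An n k l by rewrite !mxE; ring.
    exact: lexx.
  rewrite big_split/=; apply: lerD; first exact: Ha.
  apply: (le_trans (Hdiff n k)); rewrite ler_piMl//.
  by have /andP[] := n1 n.
have HA : row_bound A b by move=> k; rewrite (le_trans (Ha k))// lerDl.
(* [C] bounds the entries of the two exponentials in the integrand *)
pose C := 1 + b * expR b.
have C0 : 0 <= C by rewrite addr_ge0// mulr_ge0// expR_ge0.
pose f n (s : R) : \bar R := (duhamel_integrand A (Qn n) (An n) s i j)%:E.
have intf n : (\int[lebesgue_measure]_(s in `[0%R, 1%R]) f n s =
    (n.+1%:R * (expmx (An n) i j - expmx A i j))%:E)%E.
  have E s : duhamel_integrand A (Qn n) (An n) s =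
      - n.+1%:R *: duhamel_integrand A (A - An n) (An n) s.
    rewrite /duhamel_integrand /Qn -!scalemxAr -!scalemxAl scaleNr -scalerN.
    by rewrite -mulNmx -mulmxN opprB.
  under eq_integral do rewrite /f E mxE EFinM.
  rewrite integralZl//; last first.
    apply: continuous_compact_integrable; first exact: segment_compact.
    by apply: continuous_subspaceT; exact: continuous_duhamel_integrand.
  by rewrite expmx_duhamel -EFinM; congr EFin; ring.
(* [expmxB_le] bounds the distance by a multiple of [1/(n+1)] *)
have cexp u k l : 0 <= u <= 1 ->
    expmx (u *: An n) k l @[n --> \oo] --> expmx (u *: A) k l.
  move=> /andP[u0 u1].
  have to0 (x : R) : n.+1%:R^-1 * x @[n --> \oo] --> 0.
    by rewrite -[X in _ --> X](mul0r x); apply: cvgM; [exact: cvg_harmonic|exact: cvg_cst].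
  pose z := expmx (u *: A) k l; pose G := 1 + (expR b - 1).
  apply: (@squeeze_cvgr _ _ _ _ (fun n => z - n.+1%:R^-1 * (q * G))
    (fun n => z + n.+1%:R^-1 * (q * G))).
  - near=> n; rewrite -ler_distl -[X in X <= _](ger0_norm (normr_ge0 _)) normr_id.
    have d0 : 0 <= n.+1%:R^-1 * q by rewrite mulr_ge0// invr_ge0.
    have := expmxB_le b0 d0 u0 (HAn n) HA (Hdiff n) k l.
    rewrite -/z; set e := expmx _ k l => H.
    have h1 : `|u * (An n - A) k l| <= n.+1%:R^-1 * q.
      rewrite normrM ger0_norm//; apply: le_trans (row_bound_entry k l (Hdiff n)).
      by rewrite ler_piMl.
    have h2 : n.+1%:R^-1 * q * u * (expR (u * b) - 1) <= n.+1%:R^-1 * q * (expR b - 1).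
      apply: (@le_trans _ _ (n.+1%:R^-1 * q * u * (expR b - 1))).
        by rewrite ler_wpM2l ?mulr_ge0 ?invr_ge0// lerD2r ler_expR ler_piMl.
      rewrite ler_wpM2r//; last by rewrite ler_piMr.
      by rewrite subr_ge0 -expR0 ler_expR.
    have -> : e - z = (e - z - u * (An n - A) k l) + u * (An n - A) k l by ring.
    apply: (le_trans (ler_normD _ _)); rewrite mulrA /G mulrDr mulr1 addrC.
    by apply: lerD => //; exact: le_trans h2.
  - by rewrite -[X in _ --> X]subr0; apply: cvgB; [exact: cvg_cst|exact: to0].
  - by rewrite -[X in _ --> X]addr0; apply: cvgD; [exact: cvg_cst|exact: to0].
have bound n s : 0 <= s <= 1 -> `|duhamel_integrand A (Qn n) (An n) s i j| <=
    (K%:R * C) * (q * C).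
  move=> /andP[s0 s1].
  have s01 : 0 <= 1 - s <= 1 by apply/andP; split; lra.
  rewrite /duhamel_integrand -mulmxA; apply: row_bound_mul.
  - by rewrite mulr_ge0.
  - move=> k; apply: (@le_trans _ _ (\sum_(l < K) C)).
      by apply: ler_sum => l _; apply: expmx_bounded => //; rewrite s0.
    by rewrite sumr_const card_ord mulr_natl.
  move=> k l; apply: row_bound_mul => // k' l'.
  exact: expmx_bounded.
have mitv : measurable (`[0, 1]%classic : set (measurableTypeR R)) by exact: measurable_itv.
have mf (n : nat) : @measurable_fun _ _ (measurableTypeR R) _ `[0%R, 1%R]%classic (f n).
  apply/measurable_EFinP; apply: measurable_funTS; apply: continuous_measurable_fun.
  exact: continuous_duhamel_integrand.
have := @dominated_convergence _ (measurableTypeR R) R lebesgue_measure `[0%R, 1%R]%classic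
  mitv f (fun s => (duhamel_integrand A Q A s i j)%:E) (cst ((K%:R * C) * (q * C))%:E) mf.
case.
- apply/measurable_EFinP; apply: measurable_funTS; apply: continuous_measurable_fun.
  exact: continuous_duhamel_integrand.
- apply: aeW => s; rewrite /= in_itv/= => /andP[s0 s1].
  apply: cvg_EFin; first by near=> n.
  apply: cvg_mxmul; last by move=> k l; apply: cexp; apply/andP; split; lra.
  by apply: cvg_mxmul => // k l; exact: cvg_cst.
- apply: (@continuous_compact_integrable _ (cst ((K%:R * C) * (q * C)))); first exact: segment_compact.
  by apply: continuous_subspaceT => s; exact: cvg_cst.
- by apply: aeW => s n; rewrite /= in_itv/= => s01; rewrite lee_fin; exact: bound.
move=> cf _ cI; have /integrable_fin_num := cf => /(_ mitv) Ifin.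
have {cI} : (n.+1%:R * (expmx (An n) i j - expmx A i j))%:E @[n --> \oo] -->
    (Rintegral lebesgue_measure `[0, 1]%classic (fun s => duhamel_integrand A Q A s i j))%:E.
  rewrite /Rintegral fineK//; apply: cvg_trans cI; apply: near_eq_cvg.
  by near=> n; rewrite /= intf.
by move/fine_cvgP => [_].
Unshelve. all: by end_near. Qed.

End Duhamel.

(** * Differentiation of exponential moments *)

Section ExponentialMoments.
Context (R : realType) (d : measure_display) (T : measurableType d)
  (mu : {measure set T -> \bar R}) (D : set T) (Y : T -> R).
Hypotheses (mD : measurable D) (mY : measurable_fun D Y).

Lemma measurable_expRM (q : R) : measurable_fun D (fun x => expR (q * Y x)).
Proof.
apply: measurableT_comp; first exact: measurable_expR.
by apply: measurable_funM => //; exact: measurable_cst.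
Qed.

Lemma is_derive_expRM (y k q : R) :
  is_derive q 1 (fun s : R => expR (s * y) - k) (y * expR (q * y)).
Proof.
have d1 : is_derive q 1 (fun s : R => s * y) y.
  have := @is_deriveM _ _ id (cst y) q 1 _ _ (is_derive_id _ _) (is_derive_cst _ _ _).
  by rewrite scaler0 add0r [_ *: _]mulr1.
have d2 := @is_derive1_comp R expR (fun s : R => s * y) q _ _
  (is_derive_expR _) d1.
have := is_deriveB d2 (is_derive_cst k q (1 : R)).
by rewrite subr0 mulrC.
Qed.

(** The constant [k] is there for the Levy measure: it is infinite in general, so
    that [expR (q * Y)] itself is not integrable, but [expR (q * Y) - 1] is. *)
Lemma derivable_exp_moment (k p e : R) (G : T -> R) : 0 < e ->
  (forall q : R, p - e < q < p + e ->
    mu.-integrable D (EFin \o (fun x => expR (q * Y x) - k))) ->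
  mu.-integrable D (EFin \o G) -> (forall x, 0 <= G x) ->
  (forall (q : R) x, p - e < q < p + e -> D x -> `|Y x * expR (q * Y x)| <= G x) ->
  is_derive p 1 (fun q : R => Rintegral mu D (fun x => expR (q * Y x) - k))
    (Rintegral mu D (fun x => Y x * expR (p * Y x))).
Proof.
move=> e0 intf intG G0 Gub.
have pI : `]p - e, p + e[%classic p by rewrite /= in_itv/=; apply/andP; split; lra.
have d1E q x : partial1of2 (fun q x => expR (q * Y x) - k) q x = Y x * expR (q * Y x).
  rewrite /partial1of2 derive1E.
  by have [_ ->] := is_derive_expRM (Y x) k q.
have H1 : forall q : R, `]p - e, p + e[%classic q ->
    mu.-integrable D (EFin \o (fun x => expR (q * Y x) - k)).
  by move=> q; rewrite /= in_itv/= => ?; exact: intf.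
have H2 : forall (q : R) x, `]p - e, p + e[%classic q -> D x ->
    derivable (fun s : R => expR (s * Y x) - k) q 1.
  by move=> q x _ _; have [] := is_derive_expRM (Y x) k q.
have H3 : forall (q : R) x, `]p - e, p + e[%classic q -> D x ->
    `|partial1of2 (fun q x => expR (q * Y x) - k) q x| <= G x.
  by move=> q x; rewrite /= in_itv/= d1E => ?; exact: Gub.
apply: DeriveDef.
  exact: (derivable_under_integral mD pI H1 H2 G0 intG H3).
rewrite -derive1E (differentiation_under_integral mD pI H1 H2 G0 intG H3).
by under eq_Rintegral do rewrite d1E.
Qed.

Lemma le_integrable_real (f g : T -> R) : measurable_fun D f ->
  (forall x, D x -> `|f x| <= g x) ->
  mu.-integrable D (EFin \o g) -> mu.-integrable D (EFin \o f).
Proof.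
move=> mf fg ig; apply: (le_integrable mD _ _ ig); first exact/measurable_EFinP.
by move=> x Dx /=; rewrite lee_fin (le_trans (fg _ Dx))// ler_norm.
Qed.

Lemma expRM_le_sum (a b q y : R) : a <= q <= b ->
  expR (q * y) <= expR (a * y) + expR (b * y).
Proof.
move=> /andP[aq qb]; have [y0|y0] := leP 0 y.
  by rewrite ler_wpDl ?expR_ge0// ler_expR ler_wpM2r.
by rewrite ler_wpDr ?expR_ge0// ler_expR ler_wnM2r// ltW.
Qed.

Lemma integrable_expRM (a b q : R) : a <= q <= b ->
  mu.-integrable D (EFin \o (fun x => expR (a * Y x))) ->
  mu.-integrable D (EFin \o (fun x => expR (b * Y x))) ->
  mu.-integrable D (EFin \o (fun x => expR (q * Y x))).
Proof.
move=> qab ia ib.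
apply: (@le_integrable_real _ (fun x => expR (a * Y x) + expR (b * Y x))).
- exact: measurable_expRM.
- by move=> x Dx; rewrite ger0_norm ?expR_ge0// expRM_le_sum.
- exact: integrableD ia ib.
Qed.

(** A polynomial factor costs an exponential factor with an arbitrarily small
    rate [e]; it can be absorbed inside the interval of finiteness. *)
Lemma ler_normM_expR (a b q e y : R) : 0 < e -> a <= q - e -> q + e <= b ->
  `|y * expR (q * y)| <= e^-1 * 2 * (expR (a * y) + expR (b * y)).
Proof.
move=> e0 aq qb; rewrite normrM (ger0_norm (expR_ge0 _)).
have ey : e * `|y| <= expR (e * `|y|).
  by rewrite (le_trans _ (expR_ge1Dx _))// lerDr.
have h : expR (e * `|y|) * expR (q * y) <= 2 * (expR (a * y) + expR (b * y)).
  rewrite -expRD; have [y0|y0] := leP 0 y.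
    rewrite (ger0_norm y0) (_ : e * y + q * y = (q + e) * y); last by ring.
    rewrite (le_trans (@expRM_le_sum a b _ _ _))//; first by apply/andP; split; lra.
    by rewrite ler_peMl ?addr_ge0 ?expR_ge0// ler1n.
  rewrite (ltr0_norm y0) (_ : e * - y + q * y = (q - e) * y); last by ring.
  rewrite (le_trans (@expRM_le_sum a b _ _ _))//; first by apply/andP; split; lra.
  by rewrite ler_peMl ?addr_ge0 ?expR_ge0// ler1n.
rewrite -[leLHS](mulKf (lt0r_neq0 e0)) -mulrA ler_wpM2l ?invr_ge0 ?(ltW e0)//.
by apply: le_trans h; rewrite mulrA ler_wpM2r ?expR_ge0.
Qed.

(** Strictly inside its interval of finiteness a moment generating function
    may be differentiated under the integral sign. *)
Lemma is_derive_mgf (a p b : R) : a < p < b ->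
  mu.-integrable D (EFin \o (fun x => expR (a * Y x))) ->
  mu.-integrable D (EFin \o (fun x => expR (b * Y x))) ->
  is_derive p 1 (fun q : R => Rintegral mu D (fun x => expR (q * Y x)))
    (Rintegral mu D (fun x => Y x * expR (p * Y x))).
Proof.
move=> /andP[ap pb] ia ib.
pose e := Num.min (p - a) (b - p) / 2.
have e0 : 0 < e by rewrite divr_gt0// lt_min !subr_gt0 ap.
have [ea eb] : 2 * e <= p - a /\ 2 * e <= b - p.
  by rewrite /e mulrC divfK ?pnatr_eq0// ge_min lexx; split => //; rewrite ge_min lexx orbT.
under eq_fun => q do under eq_Rintegral do rewrite -[expR _]subr0.
apply: (@derivable_exp_moment 0 p e
  (fun x => e^-1 * 2 * (expR (a * Y x) + expR (b * Y x)))) => //.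
- move=> q qe; under [X in EFin \o X]eq_fun do rewrite subr0.
  apply: (@integrable_expRM a b) => //.
  by case/andP: qe => ? ?; apply/andP; split; lra.
- have -> : EFin \o (fun x => e^-1 * 2 * (expR (a * Y x) + expR (b * Y x))) =
    (fun x => (e^-1 * 2)%:E *
      ((EFin \o (fun x => expR (a * Y x))) \+ (EFin \o (fun x => expR (b * Y x)))) x)%E.
    by apply/funext => x /=; rewrite EFinM EFinD.
  by apply: integrableZl => //; exact: integrableD.
- by move=> x; rewrite !mulr_ge0 ?addr_ge0 ?expR_ge0 ?invr_ge0 ?(ltW e0).
- by move=> q x /andP[? ?] Dx; apply: ler_normM_expR => //; lra.
Qed.

Lemma integrable_Y_mgf (a p b : R) : a < p < b ->
  mu.-integrable D (EFin \o (fun x => expR (a * Y x))) ->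
  mu.-integrable D (EFin \o (fun x => expR (b * Y x))) ->
  mu.-integrable D (EFin \o (fun x => Y x * expR (p * Y x))).
Proof.
move=> /andP[ap pb] ia ib.
pose e := Num.min (p - a) (b - p).
have e0 : 0 < e by rewrite lt_min !subr_gt0 ap.
have [ea eb] : e <= p - a /\ e <= b - p.
  by rewrite /e ge_min lexx; split => //; rewrite ge_min lexx orbT.
apply: (@le_integrable_real _
  (fun x => e^-1 * 2 * (expR (a * Y x) + expR (b * Y x)))).
- by apply: measurable_funM => //; exact: measurable_expRM.
- by move=> x Dx; apply: ler_normM_expR => //; lra.
- have -> : EFin \o (fun x => e^-1 * 2 * (expR (a * Y x) + expR (b * Y x))) =
    (fun x => (e^-1 * 2)%:E *
      ((EFin \o (fun x => expR (a * Y x))) \+ (EFin \o (fun x => expR (b * Y x)))) x)%E.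
    by apply/funext => x /=; rewrite EFinM EFinD.
  by apply: integrableZl => //; exact: integrableD.
Qed.

End ExponentialMoments.

(** * The Bernstein matrix at the origin *)

Section BernsteinMatrix.
Context (R : realType) (K : nat) (c : characteristics R K).
Hypotheses (adm : admissible c) (hp : (underline_p c < 0)%E)
  (hkill : forall i, killing c i = 0).

Lemma underline_p_neg : exists p : R, [/\ p < 0,
  (forall i, (\int[levy c i]_(x in `]0%R, +oo[)
                 (expR (- (p * x)) - 1)%:E < +oo)%E) &
  (forall i j, ((rate c i j)%:E *
       \int[jump_law c i j]_(x in `[0%R, +oo[) (expR (- (p * x)))%:E
         < +oo)%E)].
Proof.
move: hp => /ereal_inf_ltP[_ [p [h1 h2] <-]]; rewrite lte_fin => p0.
by exists p.
Qed.

Lemma measurable_opp (D : set R) : measurable_fun D (-%R : R -> R).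
Proof. exact/measurable_funN/measurable_id. Qed.

(** The derivative of the integrand is dominated by a multiple of
    [expR (- (p0 * x)) - 1], which is integrable for some [p0 < 0]: near the
    origin it is comparable to [x], at infinity to [expR (- (p0 * x))]. *)
Lemma is_derive_levy_part i : exists l : R,
  is_derive (0 : R) 1 (fun p : R => Rintegral (levy c i) `]0, +oo[%classic
     (fun x : R => 1 - expR (- (p * x)))) l.
Proof.
have [p0 [p00 + _]] := underline_p_neg; move=> /(_ i) hl.
pose D := `]0, +oo[%classic : set R.
have mD : measurable D by exact: measurable_itv.
(* half of [- p0] bounds the parameter, the other half absorbs the factor [x] *)
pose e := - p0 / 2.
have e0 : 0 < e by rewrite divr_gt0// oppr_gt0.
have D0 x : D x -> 0 < x by rewrite /D /= in_itv/= andbT.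
pose G x := e^-1 * `|expR (- (p0 * x)) - 1|.
have mexp (q : R) : measurable_fun D (fun x => expR (q * - x) : R).
  by apply: (measurable_expRM _ q); exact: measurable_opp.
have iG : (levy c i).-integrable D (EFin \o G).
  have -> : EFin \o G = (fun x => (e^-1)%:E * (`|expR (p0 * - x) - 1|%R)%:E)%E.
    by apply/funext => x; rewrite /G /= EFinM mulrN.
  apply: integrableZl => //; apply/integrableP; split.
    apply/measurable_EFinP; apply: measurableT_comp; first exact: normr_measurable.
    by apply: measurable_funB => //; exact: mexp.
  apply: le_lt_trans hl; rewrite le_eqVlt; apply/orP; left; apply/eqP.
  apply: eq_integral => x /set_mem/D0 x0 /=; rewrite normr_id mulrN ger0_norm//.
  by rewrite subr_ge0 -expR0 ler_expR oppr_ge0 mulr_le0_ge0// ltW.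
(* with [z = e * x]: [z * expR z <= expR (2 * z) - 1] *)
have key (x q : R) : D x -> - e < q < e -> `|x * expR (q * - x)| <= G x.
  move=> /D0 x0 /andP[q1 q2].
  rewrite normrM (ger0_norm (expR_ge0 _)) (gtr0_norm x0) /G ger0_norm; last first.
    by rewrite subr_ge0 -expR0 ler_expR oppr_ge0 mulr_le0_ge0// ltW.
  rewrite ler_pdivlMl//.
  have -> : - (p0 * x) = e * x + e * x by rewrite /e; field.
  have h1 : 1 + e * x <= expR (e * x) by exact: expR_ge1Dx.
  have h2 : expR (q * - x) <= expR (e * x).
    by rewrite ler_expR mulrN -mulNr ler_wpM2r// ?ltW//; lra.
  have h3 : 1 <= expR (e * x) by rewrite -expR0 ler_expR mulr_ge0// ltW.
  rewrite expRD; apply: (@le_trans _ _ (e * x * expR (e * x))).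
    by rewrite -mulrA ler_wpM2l ?(ltW e0)// ler_wpM2l// ltW.
  by nra.
have intf (q : R) : - e < q < e ->
    (levy c i).-integrable D (EFin \o (fun x => expR (q * - x) - 1)).
  move=> qe; apply: (@le_integrable_real R _ (measurableTypeR R) (levy c i) D mD _ (fun x => e * G x)).
  - by apply: measurable_funB => //; exact: mexp.
  - move=> x Dx; have x0 := D0 _ Dx; have [q1 q2] := andP qe.
    rewrite /G mulVKf ?gt_eqF//.
    rewrite [leRHS]ger0_norm; last first.
      by rewrite subr_ge0 -expR0 ler_expR oppr_ge0 mulr_le0_ge0// ltW.
    have [q0|q0] := leP 0 q.
      rewrite ler0_norm; last by rewrite subr_le0 -expR0 ler_expR mulrN oppr_le0 mulr_ge0// ltW.
      have h1 : 1 + q * - x <= expR (q * - x) by exact: expR_ge1Dx.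
      have h2 : 1 + - (p0 * x) <= expR (- (p0 * x)) by exact: expR_ge1Dx.
      have h3 : q * x <= - (p0 * x).
        by rewrite -mulNr ler_wpM2r// ?ltW//; rewrite /e in q2 *; lra.
      by rewrite mulrN in h1 *; lra.
    rewrite ger0_norm; last by rewrite subr_ge0 -expR0 ler_expR mulrN -mulNr mulr_ge0// ?ltW// oppr_gt0.
    by rewrite lerD2r ler_expR mulrN lerN2 ler_wpM2r ?(ltW x0)// ; rewrite /e in q1; lra.
  - have -> : EFin \o (fun x => e * G x) = (fun x => e%:E * (EFin \o G) x)%E.
      by apply/funext => x; rewrite /= EFinM.
    exact: integrableZl.
have G0 x : 0 <= G x by rewrite /G mulr_ge0 ?invr_ge0// ltW.
have d1 := @derivable_exp_moment R _ _ (levy c i) D (fun x : R => - x) mD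
  1 0 e G e0 _ iG G0 _.
have {}d1 : is_derive (0 : R) 1 (fun q => Rintegral (levy c i) D (fun x => expR (q * - x) - 1))
    (Rintegral (levy c i) D (fun x => - x * expR (0 * - x))).
  apply: d1.
  - by move=> q; rewrite !add0r; exact: intf.
  - by move=> q x; rewrite !add0r mulNr normrN => qe Dx; exact: key.
exists (- (Rintegral (levy c i) D (fun x => - x * expR (0 * - x)))).
apply: near_eq_is_derive (is_deriveN d1).
near=> q.
have qe : - e < q < e.
  apply/andP; split; near: q; [apply: lt_nbhsr|apply: lt_nbhsl] => //.
  by rewrite oppr_lt0.
have := @RintegralZl _ (measurableTypeR R) R (levy c i) D _ (-1) mD (intf _ qe).
rewrite mulN1r => /esym E; apply: etrans E _; apply: eq_Rintegral => x _.
by rewrite mulN1r opprB mulrN.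
Unshelve. all: by end_near. Qed.

Lemma jump_laplace_diag i p : jump_laplace c i i p = 1.
Proof.
rewrite /jump_laplace /Rintegral.
pose m2 : {measure set (measurableTypeR R) -> \bar R} := @dirac _ (measurableTypeR R) 0 R.
have H (A : set (measurableTypeR R)) : measurable A -> A `<=` `[0%R, +oo[%classic ->
    jump_law c i i A = m2 A.
  by move=> mA _; exact: (jump_law_diag adm).
rewrite (@eq_measure_integral _ (measurableTypeR R) _ _ m2 _ _ H) integral_dirac//.
  rewrite diracE mem_set ?mul1e/= ?in_itv/= ?lexx//.
  by rewrite mulr0 oppr0 expR0.
apply/measurable_EFinP.
rewrite (_ : (fun x : R => expR (- (p * x))) = (fun x => expR (p * - x))).
  by apply: measurable_expRM => //; exact: measurable_opp.
by apply/funext => x; rewrite mulrN.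
Qed.

Lemma integrable_exp_jump i j (p : R) : i != j -> 0 < rate c i j ->
  ((rate c i j)%:E * \int[jump_law c i j]_(x in `[0%R, +oo[) (expR (- (p * x)))%:E
         < +oo)%E ->
  (jump_law c i j).-integrable `[0%R, +oo[%classic
    (EFin \o (fun x : R => expR (p * - x))).
Proof.
move=> ij r0 h; apply/integrableP; split.
  by apply/measurable_EFinP/measurable_expRM => //; exact: measurable_opp.
under eq_integral do rewrite /= ger0_norm ?expR_ge0// mulrN.
rewrite ltey; apply/eqP => H; move: h; rewrite H gt0_muley ?ltxx// lte_fin.
Qed.

(** When the rate vanishes, the jump law has no finite exponential moments in
    general, but the product with the rate is constant. *)
Lemma is_derive_jump_part i j : exists l : R,
  is_derive (0 : R) 1 (fun p => rate c i j * jump_laplace c i j p) l.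
Proof.
have [p0 [p00 _ +]] := underline_p_neg; move=> /(_ i j) hl.
have [->|ij] := eqVneq i j.
  exists 0; under eq_fun do rewrite jump_laplace_diag mulr1.
  exact: is_derive_cst.
have [r0|r0] := eqVneq (rate c i j) 0.
  exists 0; rewrite r0; under eq_fun do rewrite mul0r; exact: is_derive_cst.
have rp : 0 < rate c i j by rewrite lt0r r0 (rate_ge0 adm).
have i1 := integrable_exp_jump ij rp hl.
have i2 : (jump_law c i j).-integrable `[0%R, +oo[%classic
    (EFin \o (fun x : R => expR (1 * - x))).
  apply: (@le_integrable_real R _ (measurableTypeR R) (jump_law c i j) _ _ _ (fun=> 1)).
  - exact: measurable_itv.
  - by apply: measurable_expRM => //; exact: measurable_opp.
  - move=> x; rewrite /= in_itv/= andbT => x0.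
    by rewrite ger0_norm ?expR_ge0// mul1r -expR0 ler_expR oppr_le0.
  - exact: finite_measure_integrable_cst.
have p01 : p0 < 0 < (1 : R) by apply/andP; split.
have mo : @measurable_fun _ _ (measurableTypeR R) R `[0%R, +oo[%classic (fun x : R => - x).
  exact: measurable_opp.
have dd := @is_derive_mgf R _ (measurableTypeR R) (jump_law c i j) _ _
  (measurable_itv _) mo _ _ _ p01 i1 i2.
eexists; under eq_fun => p do (rewrite /jump_laplace; under eq_Rintegral do rewrite -mulrN).
exact: (is_deriveZ (rate c i j) dd).
Qed.

Lemma derivable_Phi0 i j : derivable (fun p : R => Phi c p i j) 0 1.
Proof.
have [l1 d1] := is_derive_levy_part i.
have [l2 [d2 _]] := is_derive_jump_part i j.
have -> : (fun p : R => Phi c p i j) = (fun p => psi c i p *+ (i == j)) -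
    (fun p => rate c i j * jump_laplace c i j p).
  by apply/funext => p; rewrite !mxE.
apply: derivableB; last exact: d2.
have [_|_] := eqVneq i j; last first.
  by under eq_fun do rewrite mulr0n; exact: derivable_cst.
under eq_fun do rewrite mulr1n.
have [d1' _] := d1.
by rewrite /psi; apply: derivableD.
Qed.

Lemma Phi0E : Phi c 0 = - rate c.
Proof.
apply/matrixP => i j; rewrite !mxE.
have -> : psi c i 0 = 0.
  rewrite /psi hkill mulr0 !add0r /Rintegral integral0_eq//.
  by move=> x _; rewrite mul0r oppr0 expR0 subrr.
have -> : jump_laplace c i j 0 = 1.
  rewrite /jump_laplace; under eq_Rintegral do rewrite mul0r oppr0 expR0.
  rewrite Rintegral_cst// mul1r.
  by have /(congr1 fine) := jump_law_ge0 adm i j.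
by rewrite mulr1 mul0rn sub0r.
Qed.

End BernsteinMatrix.

(** * Integrals of nonincreasing functions *)

Section NonincreasingIntegral.
Context (R : realType).
Local Notation mu := (@lebesgue_measure R).
Local Open Scope ereal_scope.

Lemma lebesgue_measure_shift (t : R) (A : set R) : measurable A ->
  pushforward mu ((fun x => t + x)%R : _ -> measurableTypeR R) A = mu A.
Proof.
move=> mA.
have mt : measurable_fun setT ((fun x => t + x)%R : measurableTypeR R -> measurableTypeR R).
  by apply: measurable_funD.
apply/esym.
have := @lebesgue_measure_unique R (pushforward mu
  ((fun x => t + x)%R : measurableTypeR R -> measurableTypeR R)).
apply => // _ [[u v]] _ <-.
rewrite /pushforward [X in _ = mu X](_ : _ = `]u - t, v - t]%classic)%R; last first.
  by apply/seteqP; split => x /=; rewrite !in_itv/= => /andP[? ?]; apply/andP; split; lra.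
rewrite !lebesgue_measure_itv/= !lte_fin ltrD2r; case: ifP => // _.
by rewrite -!EFinB; congr EFin; ring.
Qed.

Variable a : R -> R.
Hypothesis a0 : forall x, (0 <= a x)%R.
Hypothesis am : nonincreasing_fun a.

Let ma (D : set (measurableTypeR R)) : measurable D ->
  @measurable_fun _ _ (measurableTypeR R) _ D (fun x : R => (a x)%:E).
Proof. by move=> mD; apply/measurable_EFinP; exact: nonincreasing_measurable. Qed.

(** Monotonicity replaces [a] on an interval by its values at the end points. *)
Lemma integral_itv_bounds (u v : R) : (u <= v)%R ->
  ((v - u) * a v)%:E <= \int[mu]_(x in `]u, v]) (a x)%:E <= ((v - u) * a u)%:E.
Proof.
move=> uv.
have H k : \int[mu]_(x in `]u, v]) (cst k%:E) x = ((v - u) * k)%:E.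
  rewrite integral_cst//= lebesgue_measure_itv/= lte_fin.
  move: uv; rewrite le_eqVlt => /predU1P[->|->]; first by rewrite ltxx mule0 subrr mul0r.
  by rewrite -EFinB -EFinM mulrC.
rewrite -!H; apply/andP; split; apply: ge0_le_integral => //=.
- by move=> ? _; rewrite lee_fin.
- exact: (ma (measurable_itv _)).
- by move=> x; rewrite in_itv/= => /andP[_ ?]; rewrite lee_fin am.
- by move=> ? _; rewrite lee_fin.
- exact: (ma (measurable_itv _)).
- by move=> x; rewrite in_itv/= => /andP[/ltW ? _]; rewrite lee_fin am.
Qed.

Lemma integral_itv_split (u v : R) : (0 <= u <= v)%R ->
  \int[mu]_(x in `[0%R, v]) (a x)%:E =
  \int[mu]_(x in `[0%R, u]) (a x)%:E + \int[mu]_(x in `]u, v]) (a x)%:E.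
Proof.
move=> /andP[u0 uv].
rewrite (@itv_bndbnd_setU _ _ (BLeft 0%R) (BRight u) (BRight v)) ?bnd_simp//.
rewrite ge0_integral_setU//=.
  by apply: (@ma _ _); exact: measurableU.
  by move=> ? _; rewrite lee_fin.
rewrite disj_set2E; apply/eqP/seteqP; split => // x [] /=; rewrite !in_itv/=.
by move=> /andP[_ xu] /andP[/lt_le_trans/(_ xu)]; rewrite ltxx.
Qed.

Lemma integral_itv_sums (h : R) (m : nat) : (0 <= h)%R ->
  (\sum_(k < m) h * a (k.+1%:R * h))%:E <=
    \int[mu]_(x in `[0%R, (m%:R * h)%R]) (a x)%:E <=
  (\sum_(k < m) h * a (k%:R * h))%:E.
Proof.
move=> h0; elim: m => [|m /andP[ih1 ih2]].
  by rewrite !big_ord0 mul0r set_itv1 integral_set1 lexx.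
have mh : (0 <= m%:R * h <= m.+1%:R * h)%R.
  by rewrite mulr_ge0//= ler_wpM2r// ler_nat.
have E : (m.+1%:R * h - m%:R * h = h)%R by rewrite -natr1; ring.
have /andP[/andP[_ mh2]] := conj mh isT.
have := integral_itv_bounds (proj2 (andP mh)); rewrite E => /andP[b1 b2].
rewrite (integral_itv_split mh) !big_ord_recr/= !EFinD.
by apply/andP; split; apply: leeD.
Qed.

Lemma integral_shift (t : R) : (0 <= t)%R ->
  \int[mu]_(x in `[0%R, +oo[) (a x)%:E = \int[mu]_(x in `[0%R, t]) (a x)%:E +
  \int[mu]_(x in `[0%R, +oo[) (a (t + x))%:E.
Proof.
move=> t0.
have -> : \int[mu]_(x in `[0%R, +oo[) (a (t + x))%:E =
    \int[mu]_(x in `[t, +oo[) (a x)%:E.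
  rewrite (_ : `[0%R, +oo[%classic =
    ((fun x => t + x)%R : measurableTypeR R -> measurableTypeR R) @^-1` `[t, +oo[); last first.
    by apply/seteqP; split => x /=; rewrite !in_itv/= !andbT lerDl.
  have mt : measurable_fun setT ((fun x => t + x)%R : measurableTypeR R -> measurableTypeR R).
    by apply: measurable_funD.
  rewrite -(@ge0_integral_pushforward _ _ _ (measurableTypeR R) R _ mt mu _ (EFin \o a))//=.
  - apply: eq_measure_integral => //= A mA AS; exact: lebesgue_measure_shift.
  - exact: (ma (measurable_itv _)).
  - by move=> ? _; rewrite lee_fin.
rewrite -(@integral_itv_obnd_cbnd _ t)//; last exact: (ma (measurable_itv _)).
rewrite (@itv_bndbnd_setU _ _ (BLeft 0%R) (BRight t) +oo%O) ?bnd_simp//.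
rewrite ge0_integral_setU//=.
  by apply: (@ma _ _); exact: measurableU.
  by move=> ? _; rewrite lee_fin.
rewrite disj_set2E; apply/eqP/seteqP; split => // x [] /=; rewrite !in_itv/= andbT.
by move=> /andP[_ xu] /lt_le_trans/(_ xu); rewrite ltxx.
Qed.

Lemma integral_ge_itv (t : R) :
  \int[mu]_(x in `[0%R, t]) (a x)%:E <= \int[mu]_(x in `[0%R, +oo[) (a x)%:E.
Proof.
apply: ge0_subset_integral => //=; first exact: (ma (measurable_itv _)).
  by move=> ? _; rewrite lee_fin.
exact: subset_itvl.
Qed.

(** Right Riemann sums, which for a nonincreasing function are lower sums. They
    depend only on the values at countably many times. *)
Definition riemann_sup (b : R -> R) : \bar R :=
  ereal_sup (range (fun n : nat => ereal_sup (range (fun m : nat =>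
    (\sum_(k < m) n.+1%:R^-1 * b (k.+1%:R * n.+1%:R^-1))%:E)))).

(** On [0, M+1] the right and the left Riemann sums with mesh [1/(n+1)] differ by
    at most [a 0 / n.+1]. *)
Lemma integral_riemann_sup :
  \int[mu]_(x in `[0%R, +oo[) (a x)%:E = riemann_sup a.
Proof.
apply/eqP; rewrite eq_le; apply/andP; split; last first.
  apply: ge_ereal_sup => _ [n _ <-]; apply: ge_ereal_sup => _ [m _ <-].
  apply: le_trans (integral_ge_itv (m%:R * n.+1%:R^-1)).
  by have /andP[] := @integral_itv_sums n.+1%:R^-1 m (ltac:(by [])).
rewrite ge0_integral_ereal_sup//; last exact: nonincreasing_measurable.
apply: ge_ereal_sup => _ [M _ <-].
have key n : \int[mu]_(x in `[0%R, M.+1%:R]) (a x)%:E <=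
    riemann_sup a + (n.+1%:R^-1 * a 0)%:E.
  have := @integral_itv_sums n.+1%:R^-1 (M.+1 * n.+1) (ltac:(by [])).
  rewrite natrM mulfK ?pnatr_eq0// => /andP[_ /le_trans]; apply.
  apply: (@le_trans _ _ ((\sum_(k < M.+1 * n.+1) n.+1%:R^-1 * a (k.+1%:R / n.+1%:R)) + n.+1%:R^-1 * a 0)%:E).
    rewrite lee_fin mulSn addSn big_ord_recl/= mul0r addrC lerD2r.
    rewrite big_ord_recr/= lerDl.
    by rewrite mulr_ge0.
  rewrite EFinD leeD2r//; apply: (@le_trans _ _ (ereal_sup (range (fun m : nat =>
    (\sum_(k < m) n.+1%:R^-1 * a (k.+1%:R * n.+1%:R^-1))%:E)))).
    by apply: ereal_sup_ubound; exists (M.+1 * n.+1)%N.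
  by apply: ereal_sup_ubound; exists n.
apply/lee_addgt0Pr => e e0.
pose n := Num.truncn (a 0 / e); apply: (le_trans (key n)).
rewrite leeD2l// lee_fin ler_pdivrMl// mulrC -ler_pdivrMl// mulrC.
by rewrite ltW// truncnS_gt.
Qed.

(** The series is the left Riemann sum with mesh [N.+1]. *)
Lemma integral_le_series (N : nat) :
  \int[mu]_(x in `[0%R, +oo[) (a x)%:E <=
  \sum_(0 <= k <oo) (N.+1%:R * a (k%:R * N.+1%:R))%:E.
Proof.
rewrite ge0_integral_ereal_sup//; last exact: nonincreasing_measurable.
apply: ge_ereal_sup => _ [M _ <-].
apply: (@le_trans _ _ (\int[mu]_(x in `[0%R, (M.+1%:R * N.+1%:R)%R]) (a x)%:E)).
  apply: ge0_subset_integral => //=; first exact: (ma (measurable_itv _)).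
    by move=> ? _; rewrite lee_fin.
  by apply: subset_itvl; rewrite bnd_simp -natrM ler_nat leq_pmulr.
have /andP[_ /le_trans] := @integral_itv_sums N.+1%:R M.+1 (ltac:(by [])); apply.
rewrite -sumEFin -(big_mkord xpredT (fun k => (N.+1%:R * a (k%:R * N.+1%:R))%:E)).
apply: nneseries_lim_ge => k _ _; by rewrite lee_fin mulr_ge0.
Qed.

End NonincreasingIntegral.

(** * A product rule for integrals *)

Section RestrictedProduct.
Context (R : realType) (d d1 d2 : measure_display) (T : measurableType d)
  (T1 : measurableType d1) (T2 : measurableType d2).
Local Open Scope ereal_scope.

Lemma ge0_integral_mrestr (mu : {measure set T -> \bar R}) (D : set T)
    (mD : measurable D) (f : T -> \bar R) : measurable_fun setT f ->
  (forall x, 0 <= f x) ->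
  \int[mrestr mu mD]_x f x = \int[mu]_(x in D) f x.
Proof.
move=> mf f0.
rewrite (@ge0_negligible_integral _ _ _ (mrestr mu mD) _ (~` D))//.
- rewrite setTD setCK; apply: eq_measure_integral => A mA AD /=.
  by rewrite /mrestr setIidl.
- exact: measurableC.
- rewrite /= /mrestr; have -> : ~` D `&` D = set0 by rewrite setICl.
  exact: measure0.
Qed.

(** A product rule on rectangles extends to nonnegative functions, by
    uniqueness of the product measure and Tonelli's theorem. *)
Lemma ge0_integral_product_rule (P : probability T R) (Q : probability T2 R)
    (D : set T) (U : T -> T1) (V : T -> T2) (f : T1 -> \bar R) (g : T2 -> \bar R) :
  measurable D -> measurable_fun setT U -> measurable_fun setT V ->
  measurable_fun setT f -> measurable_fun setT g ->
  (forall x, 0 <= f x) -> (forall y, 0 <= g y) ->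
  (forall B C, measurable B -> measurable C ->
    P (D `&` U @^-1` B `&` V @^-1` C) = P (D `&` U @^-1` B) * Q C) ->
  \int[P]_(w in D) (f (U w) * g (V w)) =
  (\int[P]_(w in D) f (U w)) * \int[Q]_y g y.
Proof.
move=> mD mU mV mf mg f0 g0 PUV.
pose r : {measure set T -> \bar R} := mrestr P mD.
have m1fin : fin_num_fun (pushforward r U).
  move=> A mA; have mUA : measurable (U @^-1` A `&` D).
    by apply: measurableI => //; rewrite -[_ @^-1` _]setTI; exact: mU.
  by apply: (fin_num_measure P); exact: mUA.
pose law : {measure set T1 -> \bar R} := pushforward r U.
pose m1mixin := @Measure_isFinite.Build _ _ _ (law mU) m1fin.
pose m1 : {finite_measure set T1 -> \bar R} := HB.pack (Measure.sort (law mU)) m1mixin.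
have mUV : measurable_fun setT (fun w => (U w, V w)) by exact/measurable_fun_pair.
pose F (z : T1 * T2) := f z.1 * g z.2.
have mF : measurable_fun setT F.
  by apply: emeasurable_funM; apply: measurableT_comp.
have F0 z : 0 <= F z by exact: mule_ge0.
have mfU : measurable_fun setT (f \o U) by exact: measurableT_comp.
have mgV : measurable_fun setT (g \o V) by exact: measurableT_comp.
pose law2 : {measure set (T1 * T2) -> \bar R} := pushforward r (fun w => (U w, V w)).
transitivity (\int[law2 mUV]_z F z).
  rewrite (ge0_integral_pushforward mUV)// preimage_setT ge0_integral_mrestr//.
    exact: measurableT_comp.
  by move=> x; exact: F0.
transitivity (\int[m1 \x Q]_z F z).
  apply/esym; apply: eq_measure_integral => A mA _.
  refine (product_measure_unique _ mA) => B C mB mC.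
  rewrite /= /pushforward /r /= /mrestr.
  rewrite (_ : _ @^-1` _ = U @^-1` B `&` V @^-1` C)//.
  by rewrite setIC setIA [in RHS]setIC PUV.
rewrite (fubini_tonelli1 _ mF F0) /fubini_F.
transitivity (\int[m1]_x (f x * \int[Q]_y g y)).
  apply: eq_integral => x _; by rewrite /F/= ge0_integralZl.
rewrite ge0_integralZr//; last exact: integral_ge0.
congr (_ * _).
rewrite (ge0_integral_pushforward mU)// preimage_setT ge0_integral_mrestr//.
by move=> x; exact: f0.
Qed.

End RestrictedProduct.

(** * Measurable functionals of paths *)

Section StateSpace.
Context (R : realType) (K : nat).
Local Open Scope ereal_scope.

Definition cells : set (set (state R K)) :=
  [set C | exists (B : set R) j, measurable B /\ C = cell B j].

(** The state space with the sigma-algebra generated by the cells. *)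
Definition mstate := g_sigma_algebraType cells.

Lemma measurable_cell (B : set R) (j : 'I_K) : measurable B ->
  measurable (cell B j : set mstate).
Proof. by move=> mB; apply: sub_sigma_algebra; exists B, j. Qed.

Lemma measurable_into_state (d : measure_display) (T : measurableType d)
    (Y : T -> mstate) :
  (forall B j, measurable B -> measurable (Y @^-1` cell B j)) ->
  measurable_fun setT Y.
Proof.
move=> mY; refine (@measurability _ _ T mstate setT Y cells erefl _).
by move=> _ [_ [B [j [mB ->]]] <-]; rewrite setTI; exact: mY.
Qed.

Lemma state_decomp (A : set (state R K)) :
  A = (\big[setU/set0]_(j < K) cell [set x | A (Some (x, j))] j) `|`
      [set s | s = None /\ A None].
Proof.
apply/seteqP; split => [[[x j]|] As|s].
- left; rewrite -bigcup_seq; exists j => /=; first by rewrite mem_index_enum.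
  by exists x.
- by right.
- case=> [|[->]//]; rewrite -bigcup_seq => -[j _ [x /= Ax ->]].
  exact: Ax.
Qed.

Lemma measurable_None : measurable ([set None] : set mstate).
Proof.
rewrite (_ : [set None] = ~` (\big[setU/set0]_(j < K) (cell setT j : set mstate))).
  apply: measurableC; apply: bigsetU_measurable => j _; exact: measurable_cell.
apply/seteqP; split => [_ ->|[[x j]|]//]; rewrite -bigcup_seq.
  by move=> [j _ [x]].
by case; exists j => /=; [rewrite mem_index_enum|exists x].
Qed.

Lemma measurable_from_state (d : measure_display) (U : measurableType d)
    (f : mstate -> U) :
  (forall j, measurable_fun setT (fun x : R => f (Some (x, j)))) ->
  measurable_fun setT f.
Proof.
move=> mf _ Y mY; rewrite setTI (state_decomp (f @^-1` Y)).
apply: measurableU.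
  apply: bigsetU_measurable => j _; apply: measurable_cell.
  by have := mf j measurableT Y mY; rewrite setTI.
have [YN|YN] := pselect (Y (f None)).
  rewrite (_ : [set s | _] = [set None]); first exact: measurable_None.
  by apply/seteqP; split => [s []|s ->].
rewrite (_ : [set s | _] = set0)//.
by apply/seteqP; split => [s []|].
Qed.

Definition height (s : state R K) : R := if s is Some (x, _) then x else 0%R.

(** e^-xi, with e^-oo = 0 at the cemetery. *)
Definition decay (s : state R K) : R :=
  if s is Some (x, _) then expR (- x) else 0%R.

Lemma measurable_height : measurable_fun setT (height : mstate -> R).
Proof. by apply: measurable_from_state => j /=; exact: measurable_id. Qed.

Lemma measurable_decay : measurable_fun setT (decay : mstate -> R).
Proof.
by apply: measurable_from_state => j /=; exact: measurableT_comp.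
Qed.

Lemma decay_ge0 s : (0 <= decay s)%R.
Proof. by case: s => [[x j]|]//=; exact: expR_ge0. Qed.

Definition path_gens : set (set (R -> state R K)) :=
  [set C | exists (u : R) (B : set R) j, [/\ (0 <= u)%R, measurable B &
         C = [set f : R -> state R K | cell B j (f u)]] ].

(** The space of paths with the product sigma-algebra. *)
Definition mpath := g_sigma_algebraType path_gens.

Lemma measurable_eval (u : R) : (0 <= u)%R ->
  measurable_fun setT ((fun f : R -> state R K => f u) : mpath -> mstate).
Proof.
move=> u0; apply: measurable_into_state => B j mB.
by apply: sub_sigma_algebra; exists u, B, j.
Qed.

Lemma measurable_into_path (d : measure_display) (T : measurableType d)
    (Y : T -> mpath) :
  (forall u : R, (0 <= u)%R -> measurable_fun setT (fun w => Y w u : mstate)) ->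
  measurable_fun setT Y.
Proof.
move=> mY; refine (@measurability _ _ T mpath setT Y path_gens erefl _).
move=> _ [_ [u [B [j [u0 mB ->]]]] <-]; rewrite setTI.
have := mY u u0 measurableT _ (measurable_cell j mB).
by rewrite setTI.
Qed.

Lemma measurable_ereal_sup_range (d : measure_display) (T : measurableType d)
    (f : nat -> T -> \bar R) :
  (forall n, measurable_fun setT (f n)) ->
  measurable_fun setT (fun x => ereal_sup (range (f ^~ x))).
Proof.
move=> mf; have := measurable_fun_esups mf 0%N.
congr (measurable_fun _ _); apply/funext => x; rewrite /esups /=.
by congr ereal_sup; apply/seteqP; split => _ [n _ <-]; exists n.
Qed.

(** The exponential functional as a functional of countably many positions;
    the product sigma-algebra does not see the integral itself. *)
Definition path_functional (f : R -> state R K) : \bar R :=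
  riemann_sup (fun u => decay (f u)).

Lemma measurable_path_functional :
  measurable_fun setT (path_functional : mpath -> \bar R).
Proof.
rewrite /path_functional /riemann_sup.
apply: (@measurable_ereal_sup_range _ mpath) => n.
apply: (@measurable_ereal_sup_range _ mpath) => m.
apply/measurable_EFinP; apply: measurable_sum => k.
apply: measurable_funM; first exact: measurable_cst.
apply: (measurableT_comp measurable_decay).
by apply: measurable_eval; rewrite mulr_ge0// invr_ge0.
Qed.

(** The logarithm of the exponential functional, real valued as the functional is
    finite and positive on almost all paths. *)
Definition log_functional (f : R -> state R K) : R := ln (fine (path_functional f)).

Lemma measurable_log_functional :
  measurable_fun setT (log_functional : mpath -> R).
Proof.
apply: measurableT_comp; first exact: measurable_ln.
apply: measurableT_comp => //; exact: measurable_path_functional.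
Qed.

End StateSpace.

(** * The Markov additive property for expectations *)

Section MAPMeasurability.
Context (R : realType) (K : nat) (d : measure_display) (T : measurableType d)
  (P : R -> 'I_K -> probability T R) (X : R -> T -> state R K).
Hypothesis hMAP : is_MAP P X.

(** The position as a real number, with default value 0 at the cemetery; without
    killing the cemetery is almost surely never reached ([ae_alive]). *)
Definition real_position (t : R) (w : T) : R := height (X t w).

Definition type_event (t : R) (j : 'I_K) : set T := [set w | type_at X t w = Some j].

Lemma type_eventE t j : type_event t j = X t @^-1` cell setT j.
Proof.
apply/seteqP; split => w; rewrite /type_event/= /type_at.
  by case E : (X t w) => [[x k]|]//= [<-]; exists x.
by move=> [x _ ->].
Qed.

Lemma measurable_type_event t j : 0 <= t -> measurable (type_event t j).
Proof. by move=> t0; rewrite type_eventE; exact: (map_measurable hMAP). Qed.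

Lemma measurable_X t : 0 <= t -> measurable_fun setT (X t : T -> mstate R K).
Proof.
by move=> t0; apply: measurable_into_state => B j mB; exact: (map_measurable hMAP).
Qed.

Lemma measurable_real_position t : 0 <= t -> measurable_fun setT (real_position t).
Proof.
by move=> t0; apply: (measurableT_comp (@measurable_height R K)); exact: measurable_X.
Qed.

Lemma measurable_path : measurable_fun setT ((fun w u => X u w) : T -> mpath R K).
Proof. by apply: measurable_into_path => u u0; exact: measurable_X. Qed.

Lemma measurable_shifted t : 0 <= t ->
  measurable_fun setT (shifted X t : T -> mpath R K).
Proof.
move=> t0; apply: measurable_into_path => u u0.
have tu : 0 <= t + u by exact: addr_ge0.
apply: measurable_into_state => B j mB.
rewrite (_ : _ @^-1` _ = X t @^-1` (~` [set None]) `&` X (t + u) @^-1` cell setT j `&`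
    (real_position (t + u) \- real_position t) @^-1` B); last first.
  apply/seteqP; split => w; rewrite /= /shifted /real_position.
    case E1 : (X t w) => [[x k]|]; case E2 : (X (t + u) w) => [[y l]|] [z Bz]//= [yxz lj].
    rewrite /= yxz; split => //; split => //.
    by exists y => //; rewrite lj.
  case E1 : (X t w) => [[x k]|]; last by move=> [[]].
  by move=> [[_ [y _ ->]]] /= h; exists (y - x).
apply: measurableI; first apply: measurableI.
- have := measurable_X t0 measurableT (measurableC (@measurable_None R K)).
  by rewrite setTI.
- exact: (map_measurable hMAP).
- by rewrite -[_ @^-1` _]setTI; apply: measurable_funB => //; exact: measurable_real_position.
Qed.

(** The Markov additive property, stated for sets, extends to expectations of
    products. *)
Lemma markov_expectation x i t j (f : R -> \bar R) (g : mpath R K -> \bar R) :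
  0 <= t -> measurable_fun setT f -> measurable_fun setT g ->
  (forall y, 0 <= f y)%E -> (forall h, 0 <= g h)%E ->
  (\int[P x i]_(w in type_event t j) (f (real_position t w) * g (shifted X t w)) =
   \int[P x i]_(w in type_event t j) f (real_position t w) * \int[P 0 j]_w g (X ^~ w))%E.
Proof.
move=> t0 mf mg f0 g0.
pose Xm : {mfun T >-> mpath R K} := HB.pack ((fun w u => X u w) : T -> mpath R K)
  (isMeasurableFun.Build _ _ _ _ _ measurable_path).
have -> : (\int[P 0 j]_w g (X ^~ w) = \int[distribution (P 0 j) Xm]_h g h)%E.
  rewrite /distribution (ge0_integral_pushforward measurable_path)//.
apply: (@ge0_integral_product_rule _ _ _ _ _ _ _ (P x i) (distribution (P 0 j) Xm)
  (type_event t j) (real_position t) (shifted X t : T -> mpath R K)) => //.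
- exact: measurable_type_event.
- exact: measurable_real_position.
- exact: measurable_shifted.
move=> B C mB mC.
have E : type_event t j `&` real_position t @^-1` B = X t @^-1` cell B j `&` type_event t j.
  apply/seteqP; split => w; rewrite /type_event /type_at /= /real_position.
    by case Ew : (X t w) => [[y k]|] [//= [<-] By]; split => //; exists y.
  by move=> [[y By ->] /=].
rewrite E /distribution /pushforward /=.
apply: (map_markov_additive hMAP) => //.
apply: sub_sigma_algebra; exists t, B, j; split => //.
by rewrite t0 lexx.
Qed.

End MAPMeasurability.

(** * The integral along one path *)

Section RegularPaths.
Context (R : realType) (K : nat).
Implicit Types f : R -> state R K.

(** Pathwise version of [shifted]. *)
Definition shift_path f (t s : R) : state R K :=
  match f t, f (t + s) with
  | Some (x, _), Some (y, j) => Some (y - x, j)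
  | _, _ => None
  end.

Definition regular_path f : Prop :=
  [/\ (forall t : R, 0 <= t -> f t <> None),
      (forall s t : R, 0 <= s <= t -> height (f s) <= height (f t)) &
      height (f 0) = 0].

Definition path_integral f : \bar R :=
  (\int[lebesgue_measure]_(t in `[0%R, +oo[) (decay (f t))%:E)%E.

Lemma riemann_sup_ext (a b : R -> R) : (forall u, 0 <= u -> a u = b u) ->
  riemann_sup a = riemann_sup b.
Proof.
move=> ab; rewrite /riemann_sup; congr (ereal_sup (_ @` _)); apply/funext => n.
congr (ereal_sup (_ @` _)); apply/funext => m; congr EFin.
by apply: eq_bigr => k _; rewrite ab// mulr_ge0// invr_ge0.
Qed.

Variable f : R -> state R K.
Hypothesis rf : regular_path f.

Let h t := height (f t).

(* [decay], extended to a nonincreasing function on the whole line *)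
Let a (u : R) : R := decay (f (Num.max 0 u)).

Let decayE t : 0 <= t -> decay (f t) = expR (- h t).
Proof.
have [alive _ _] := rf; move=> /alive; rewrite /h.
by case: (f t) => [[x j]|].
Qed.

Let aE t : 0 <= t -> a t = expR (- h t).
Proof. by move=> t0; rewrite /a max_r// decayE. Qed.

Let a0 t : 0 <= a t. Proof. exact: decay_ge0. Qed.

Let am : nonincreasing_fun a.
Proof.
have [_ mono _] := rf.
move=> s t st; rewrite /a !decayE ?le_max ?lexx// ler_expR lerN2.
apply: mono; rewrite le_max lexx/= ge_max !le_max lexx/= st orbT//.
Qed.

Let tail t : \bar R := (\int[lebesgue_measure]_(x in `[0%R, +oo[) (a (t + x))%:E)%E.

Let path_integralE : path_integral f = tail 0.
Proof.
apply: eq_integral => x; rewrite inE/= in_itv/= andbT => x0.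
by rewrite add0r /a max_r.
Qed.

(** The functional of the shifted path is the tail of the integral, up to the
    normalisation by the position reached at the time of the shift. *)
Let path_functional_tail t : 0 <= t ->
  path_functional (shift_path f t) = ((expR (h t))%:E * tail t)%E.
Proof.
move=> t0; have [alive _ _] := rf.
have am' : nonincreasing_fun (fun u => expR (h t) * a (t + u)).
  by move=> u v uv; rewrite ler_wpM2l ?expR_ge0// am// lerD2l.
have a0' u : 0 <= expR (h t) * a (t + u) by rewrite mulr_ge0// expR_ge0.
transitivity (riemann_sup (fun u => expR (h t) * a (t + u))).
  apply: riemann_sup_ext => u u0; have tu : 0 <= t + u by exact: addr_ge0.
  rewrite aE// /shift_path; have := alive _ t0; have := alive _ tu.
  rewrite /h; case: (f (t + u)) => [[y l]|]// _; case: (f t) => [[x k]|]// _ /=.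
  by rewrite -expRD opprB.
rewrite -integral_riemann_sup//.
under eq_integral do rewrite EFinM.
rewrite ge0_integralZl_EFin ?expR_ge0//; first by move=> x _; rewrite lee_fin.
apply/measurable_EFinP; apply: nonincreasing_measurable => //.
by move=> u v uv; rewrite am// lerD2l.
Qed.

Lemma path_integral_functional : path_integral f = path_functional f.
Proof.
have -> : path_functional f = path_functional (shift_path f 0).
  have [alive _ h0] := rf.
  apply: riemann_sup_ext => u u0; rewrite /shift_path add0r.
  have := alive _ u0; have := alive _ (lexx 0); move: h0.
  case: (f 0) => [[x k]|]//= -> _; case: (f u) => [[y l]|]//= _.
  by rewrite subr0.
have [_ _ h0] := rf.
by rewrite path_functional_tail// /h h0 expR0 mul1e path_integralE.
Qed.

Lemma path_integral_le_series (N : nat) :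
  (path_integral f <= \sum_(0 <= k <oo) (N.+1%:R * decay (f (k%:R * N.+1%:R)))%:E)%E.
Proof.
rewrite path_integralE /tail; under [leLHS]eq_integral do rewrite add0r.
apply: (le_trans (integral_le_series a0 am N)).
rewrite le_eqVlt; apply/orP; left; apply/eqP; apply: eq_eseriesr => k _.
by rewrite /a max_r.
Qed.

Hypothesis fin : (path_integral f < +oo)%E.

Let tail_fin t : 0 <= t -> tail t \is a fin_num.
Proof.
move=> t0; rewrite ge0_fin_numE; last first.
  by apply: integral_ge0 => x _; rewrite lee_fin.
apply: le_lt_trans fin; rewrite path_integralE /tail.
under [leRHS]eq_integral do rewrite add0r.
by rewrite (integral_shift a0 am t0) leeDr// integral_ge0// => x _; rewrite lee_fin.
Qed.

Let tail_diff s t : 0 <= s <= t ->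
  (t - s) * a t <= fine (tail s) - fine (tail t) <= (t - s) * a s.
Proof.
move=> /andP[s0 st]; have t0 := le_trans s0 st.
have := integral_shift a0 am t0; rewrite (integral_shift a0 am s0).
rewrite (integral_itv_split a0 am (v := t) (u := s)) ?s0//.
have /andP[b1 b2] := integral_itv_bounds a0 am st.
have pre_fin : (\int[lebesgue_measure]_(x in `[0%R, s]) (a x)%:E)%E \is a fin_num.
  rewrite ge0_fin_numE; last by apply: integral_ge0 => x _; rewrite lee_fin.
  apply: le_lt_trans fin; rewrite path_integralE /tail.
  under [leRHS]eq_integral do rewrite add0r.
  exact: integral_ge_itv.
have mid_fin : (\int[lebesgue_measure]_(x in `]s, t]) (a x)%:E)%E \is a fin_num.
  rewrite ge0_fin_numE; last by apply: integral_ge0 => x _; rewrite lee_fin.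
  by apply: le_lt_trans b2 _; rewrite ltry.
move: pre_fin mid_fin b1 b2 => /fineK <- /fineK <-.
rewrite -/(tail s) -/(tail t) -(fineK (tail_fin s0)) -(fineK (tail_fin t0)).
rewrite !lee_fin -!EFinD => b1 b2 [] /eqP.
rewrite -addrA (inj_eq (addrI _)) => /eqP ->.
by rewrite addrK b1 b2.
Qed.

Let tail_gt0 t : 0 <= t -> 0 < fine (tail t).
Proof.
move=> t0; have t10 : 0 <= t + 1 by rewrite addr_ge0.
have /andP[h1 _] : (t + 1 - t) * a (t + 1) <= fine (tail t) - fine (tail (t + 1)) <=
    (t + 1 - t) * a t.
  by apply: tail_diff; apply/andP; split => //; rewrite lerDl.
apply: (@lt_le_trans _ _ (a (t + 1))); first by rewrite aE// expR_gt0.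
have : 0 <= fine (tail (t + 1)).
  by rewrite fine_ge0// integral_ge0// => x _; rewrite lee_fin.
move: h1; rewrite [t + 1 - t]addrAC subrr add0r mul1r; lra.
Qed.

(** The logarithm of A_t = int_t^oo e^-xi_s ds (see [expR_log_tail]). *)
Definition log_tail t := log_functional (shift_path f t) - height (f t).

Let expR_log_tail t : 0 <= t -> expR (log_tail t) = fine (tail t).
Proof.
move=> t0; rewrite /log_tail /log_functional path_functional_tail//.
rewrite fineM//= ?tail_fin//.
by rewrite lnM ?posrE ?expR_gt0 ?tail_gt0// expRK addrC addKr lnK// posrE tail_gt0.
Qed.

(** A_s - A_t is the integral over [s, t] of the nonincreasing function e^-xi. *)
Lemma log_tail_diff s t : 0 <= s <= t ->
  (t - s) * expR (- height (f t)) <= expR (log_tail s) - expR (log_tail t)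
    <= (t - s) * expR (- height (f s)).
Proof.
move=> st; have /andP[s0 st'] := st; have t0 := le_trans s0 st'.
by rewrite !expR_log_tail// -!aE//; exact: tail_diff.
Qed.

Lemma path_integral_log : path_integral f = (expR (log_functional f))%:E.
Proof.
have [_ _ h0] := rf.
have E : path_functional f = tail 0 by rewrite -path_integral_functional path_integralE.
by rewrite path_integralE /log_functional E lnK ?posrE ?tail_gt0// fineK// tail_fin.
Qed.

Lemma log_tail0 : log_tail 0 = log_functional f.
Proof.
have [_ _ h0] := rf.
rewrite /log_tail h0 subr0 /log_functional; congr (ln (fine _)).
by rewrite path_functional_tail// /h h0 expR0 mul1e -path_integral_functional path_integralE.
Qed.

End RegularPaths.

(** * Integrals of almost everywhere equal functions *)

Section AlmostEverywhereEqual.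
Context (R : realType) (d : measure_display) (T : measurableType d)
  (mu : {measure set T -> \bar R}).
Local Open Scope ereal_scope.
Import HBNNSimple.

(** Integration from below by simple functions makes this hold although [f]
    need not be measurable. *)
Lemma ge0_integral_ae_eq (f g : T -> \bar R) :
  (forall x, 0 <= f x) -> (forall x, 0 <= g x) -> measurable_fun setT g ->
  {ae mu, forall x, f x = g x} -> \int[mu]_x f x = \int[mu]_x g x.
Proof.
move=> f0 g0 mg fg; apply/eqP; rewrite eq_le; apply/andP; split.
  rewrite ge0_integralTE//; apply: ge_ereal_sup => _ [h /= hf <-].
  rewrite -integralT_nnsfun.
  apply: ae_ge0_le_integral => //=.
  - by move=> x _; rewrite lee_fin.
  - exact/measurable_EFinP.
  - by apply: filterS fg => x fgx _; rewrite -fgx; exact: hf.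
have [N [mN N0 fgN]] := fg.
rewrite (ge0_negligible_integral mN)// setTD integral_mkcond.
rewrite ge0_integralTE; last by move=> x; rewrite patchE; case: ifPn.
rewrite ge0_integralTE//; apply: ge_ereal_sup => _ [h /= hg <-].
apply: ereal_sup_ubound; exists h => //= x; apply: (le_trans (hg x)).
rewrite patchE; case: ifPn => [|_]; last exact: f0.
rewrite inE => Nx; suff -> : f x = g x by [].
by apply: contrapT => fgx; apply: Nx; exact: fgN.
Qed.

Lemma integral_eq_ae_measurable (f g : T -> \bar R) : measurable_fun setT g ->
  {ae mu, forall x, f x = g x} -> \int[mu]_x f x = \int[mu]_x g x.
Proof.
move=> mg fg; rewrite integralE [RHS]integralE; congr (_ - _).
  apply: ge0_integral_ae_eq => //; first exact: measurable_funepos.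
  by apply: filterS fg => x fgx; rewrite !unlock /= fgx.
apply: ge0_integral_ae_eq => //; first exact: measurable_funeneg.
by apply: filterS fg => x fgx; rewrite !unlock /= fgx.
Qed.

End AlmostEverywhereEqual.

(** * Laplace transforms of the position *)

Section TransitionMatrices.
Context (R : realType) (K : nat) (c : characteristics R K).

(** The matrix e^(-t Phi(p)) of the E_i[e^(-p xi_t); J_t = j]. *)
Definition bernstein_semigroup (p t : R) : 'M[R]_K := expmx (t *: - Phi c p).

Local Notation M := bernstein_semigroup.

Lemma bernstein_semigroupD p s t : M p (s + t) = M p s *m M p t.
Proof. exact: expmxD. Qed.

Lemma bernstein_semigroup0 p : M p 0 = 1%:M.
Proof. exact: expmx0. Qed.

Hypotheses (adm : admissible c) (hkill : forall i, killing c i = 0).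

Lemma bernstein_semigroup_p0 t : M 0 t = expmx (t *: rate c).
Proof. by rewrite /M Phi0E// opprK. Qed.

(** Without killing the rows of [rate c] sum to zero, hence the rows of its
    exponential sum to one. *)
Lemma bernstein_semigroup_row t i : \sum_j M 0 t i j = 1.
Proof.
pose h (s : R) : R := \sum_j M 0 s i j.
have dh (s : R) : is_derive s 1 h 0.
  have -> : h = \sum_(j < K) (fun s => M 0 s i j) by apply/funext => u; rewrite fct_sumE.
  have E0 : \sum_(j < K) (M 0 s *m rate c) i j = 0.
    under eq_bigr do rewrite mxE.
    rewrite exchange_big big1//= => k _.
    by rewrite -mulr_sumr (rate_row adm) mulr0.
  have : is_derive s 1 (\sum_(j < K) (fun s => M 0 s i j))
      (\sum_(j < K) (M 0 s *m rate c) i j).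
    apply: is_derive_sum => j; rewrite bernstein_semigroup_p0.
    have E : (fun u : R => M 0 u i j) = (fun u : R => expmx (u *: rate c) i j).
      by apply/funext => u; rewrite bernstein_semigroup_p0.
    by rewrite E; exact: is_derive_expmxr.
  by rewrite E0.
have := is_derive_0_is_cst t 0 dh; rewrite /h => ->.
rewrite bernstein_semigroup0 (bigD1 i)//= mxE eqxx big1 ?addr0// => j ji.
by rewrite mxE eq_sym (negbTE ji).
Qed.

End TransitionMatrices.

Section NoKilling.
Context (R : realType) (K : nat) (d : measure_display) (T : measurableType d)
  (P : R -> 'I_K -> probability T R) (X : R -> T -> state R K)
  (c : characteristics R K).
Hypotheses (hMAP : is_MAP P X) (hmono : nondecreasing_position P X)
  (hchar : has_characteristics P X c) (hkill : forall i, killing c i = 0)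
  (hp : (underline_p c < 0)%E).

Local Notation M := (bernstein_semigroup c).
Local Notation D := (type_event X).
Local Notation xi := (real_position X).

Let adm : admissible c. Proof. by case: hchar. Qed.

Lemma laplace_transform p t i j : (underline_p c < p%:E)%E -> 0 <= t ->
  (\int[P 0 i]_(w in D t j) (expR (- (p * xi t w)))%:E = (M p t i j)%:E)%E.
Proof.
move=> pp t0; have [_ H] := hchar.
rewrite /bernstein_semigroup scalerN -H//.
apply: eq_integral => w; rewrite inE /type_event /= /type_at /position_at /real_position.
by case: (X t w) => [[x k]|].
Qed.

Lemma bernstein_semigroup_ge0 p t i j : (underline_p c < p%:E)%E -> 0 <= t ->
  0 <= M p t i j.
Proof.
move=> pp t0; rewrite -lee_fin -laplace_transform//.
by apply: integral_ge0 => w _; rewrite lee_fin expR_ge0.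
Qed.

Lemma prob_type_event t i j : 0 <= t -> P 0 i (D t j) = (M 0 t i j)%:E.
Proof.
move=> t0; rewrite -laplace_transform//.
under eq_integral do rewrite mul0r oppr0 expR0.
by rewrite integral_cst ?mul1e//; exact: (measurable_type_event hMAP).
Qed.

Lemma trivIset_type_event t (A : set 'I_K) : trivIset A (D t).
Proof.
by move=> i j _ _ [w []]; rewrite /type_event /= => -> [].
Qed.

Lemma cemeteryE t : [set w | X t w = None] = ~` \big[setU/set0]_(j < K) D t j.
Proof.
apply/seteqP; split => w /=; rewrite -bigcup_seq /type_event /type_at.
  by move=> Xw [j _ /=]; rewrite Xw.
case E : (X t w) => [[x j]|]// h; exfalso; apply: h.
by exists j; rewrite /= ?mem_index_enum// E.
Qed.

Lemma measurable_cemetery t : 0 <= t -> measurable [set w | X t w = None].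
Proof.
move=> t0; rewrite cemeteryE; apply: measurableC; apply: bigsetU_measurable => j _.
exact: (measurable_type_event hMAP).
Qed.

(** The probabilities of the types at time [t] are a row of the stochastic matrix
    [expmx (t *: rate c)], so that they already add up to one. *)
Lemma prob_cemetery t i : 0 <= t -> P 0 i [set w | X t w = None] = 0%E.
Proof.
move=> t0; rewrite cemeteryE probability_setC; last first.
  by apply: bigsetU_measurable => j _; exact: (measurable_type_event hMAP).
have mD j : measurable (D t j) by exact: (measurable_type_event hMAP).
rewrite (measure_semi_additive_ord (P 0 i) mD)//.
- rewrite (eq_bigr (fun j => (M 0 t i j)%:E)); last first.
    by move=> j _; exact: prob_type_event.
  by rewrite sumEFin (bernstein_semigroup_row adm hkill) subee.
- exact: trivIset_type_event.
- by apply: bigsetU_measurable.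
Qed.

Lemma ge0_integral_types t i (F : T -> \bar R) : 0 <= t -> measurable_fun setT F ->
  (forall w, 0 <= F w)%E ->
  (\int[P 0 i]_w F w = \sum_j \int[P 0 i]_(w in D t j) F w)%E.
Proof.
move=> t0 mF F0.
rewrite (ge0_negligible_integral (measurable_cemetery t0))//; last exact: prob_cemetery.
rewrite setTD cemeteryE setCK ge0_integral_bigsetU//.
- by move=> j; exact: (measurable_type_event hMAP).
- exact: index_enum_uniq.
- exact: trivIset_type_event.
- exact: measurable_funS mF.
Qed.

(** The cemetery being absorbing, it is enough to look at integer times. *)
Lemma ae_alive i : {ae P 0 i, forall w, forall t : R, 0 <= t -> X t w <> None}.
Proof.
have h1 : {ae P 0 i, forall w, forall n : nat, X n%:R w <> None}.
  apply/ae_foralln => n.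
  exists [set w | X n%:R w = None]; split.
  - exact: measurable_cemetery.
  - exact: prob_cemetery.
  - by move=> w /= /contrapT.
move: h1 (map_absorbing hMAP 0 i); apply: filterS2 => w h1 h2 t t0 Xt.
apply: (h1 (Num.truncn t).+1); apply: (h2 t) => //.
by rewrite t0 ltW// truncnS_gt.
Qed.

Lemma ae_start i : {ae P 0 i, forall w, X 0 w = Some (0, i)}.
Proof.
have mS : measurable (X 0 @^-1` [set Some (0, i)]).
  rewrite (_ : [set Some (0, i)] = cell [set 0] i).
    exact: (map_measurable hMAP).
  by apply/seteqP; split => [_ ->|_ [_ -> ->]]; first by exists 0.
exists (~` (X 0 @^-1` [set Some (0, i)])); split => //.
  exact: measurableC.
by rewrite probability_setC// (map_start hMAP) subee.
Qed.

Lemma ae_regular_path i : {ae P 0 i, forall w, regular_path (X ^~ w)}.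
Proof.
apply: filterS3 (ae_alive i) (ae_start i) (hmono 0 i) => w alive start mono.
split => //; last by rewrite start.
move=> s t /andP[s0 st]; have t0 := le_trans s0 st.
have := mono s t; rewrite s0 st => /(_ isT); rewrite /position_at.
have := alive _ s0; have := alive _ t0.
by case: (X s w) => [[x k]|]//; case: (X t w) => [[y l]|]//=; rewrite lee_fin.
Qed.

Lemma exp_functionalE w : exp_functional X w = path_integral (X ^~ w).
Proof.
apply: eq_integral => t _; rewrite /position_at.
by case: (X t w) => [[x k]|].
Qed.

End NoKilling.

(** * Finiteness of the mean of the exponential functional *)

Lemma ae_eq1_integral (R : realType) (d : measure_display) (T : measurableType d)
    (Q : probability T R) (g : T -> R) : measurable_fun setT g ->
  (forall w, 0 <= g w) -> {ae Q, forall w, g w <= 1} ->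
  (\int[Q]_w (g w)%:E = 1)%E -> {ae Q, forall w, g w = 1}.
Proof.
move=> mg g0 g1 ig.
have ig' : Q.-integrable setT (EFin \o g).
  apply/integrableP; split; first exact/measurable_EFinP.
  by under eq_integral do rewrite /= ger0_norm//; rewrite ig ltry.
have i1 : Q.-integrable setT (EFin \o (fun _ : T => 1 : R)).
  exact: finite_measure_integrable_cst.
have mf : measurable_fun setT (fun w => (1 - g w)%:E).
  by apply/measurable_EFinP; apply: measurable_funB.
have : (\int[Q]_w `|(1 - g w)%:E| = 0)%E.
  transitivity (\int[Q]_w (1 - g w)%:E)%E.
    apply: ae_eq_integral => //; first exact: measurableT_comp.
    by apply: filterS g1 => w gw _ /=; rewrite ger0_norm// subr_ge0.
  have E1 : (\int[Q]_w (EFin \o (fun=> 1%R)) w = 1)%E.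
    by rewrite (integral_cst _ _ 1)// mul1e; exact: probability_setT.
  have := integralB measurableT i1 ig'.
  rewrite E1 [X in (1 - X)%E]ig (_ : 1 - 1 = 0)%E => [H|]; last exact: subee.
  apply: etrans H; apply: eq_integral => w _.
  by rewrite /= EFinB.
move/(ae_eq_integral_abs Q measurableT mf); apply: filterS => w /(_ I) [].
by move/eqP; rewrite subr_eq0 => /eqP <-.
Qed.

Lemma is_derive_cvg_right (R : realType) (f : R -> R) (l : R) :
  is_derive (0 : R) 1 f l -> h^-1 * (f h - f 0) @[h --> 0^'+] --> l.
Proof.
move=> [fd <-]; apply: cvg_dnbhs_at_right.
have : h^-1 *: ((f \o shift 0) (h *: (1 : R)) - f 0) @[h --> 0^'] --> 'D_1 f 0.
  exact: fd.
apply: cvg_trans; apply: near_eq_cvg; near=> h.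
by rewrite /= addr0 [_ *: 1]mulr1.
Unshelve. all: by end_near. Qed.

Section FiniteMean.
Context (R : realType) (K : nat) (d : measure_display) (T : measurableType d)
  (P : R -> 'I_K -> probability T R) (X : R -> T -> state R K)
  (c : characteristics R K).
Hypotheses (hMAP : is_MAP P X) (hmono : nondecreasing_position P X)
  (hchar : has_characteristics P X c) (hkill : forall i, killing c i = 0)
  (hp : (underline_p c < 0)%E) (hirr : irreducible_rate (rate c))
  (hnonconst : ~ constant_position P X).

Local Notation M := (bernstein_semigroup c).
Local Notation D := (type_event X).
Local Notation xi := (real_position X).

Let adm : admissible c. Proof. by case: hchar. Qed.

Let hp1 : (underline_p c < 1%:E)%E.
Proof. by apply: lt_trans hp _; rewrite lte_fin. Qed.

Let M1_ge0 t i j : 0 <= t -> 0 <= M 1 t i j.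
Proof. by move=> t0; apply: (bernstein_semigroup_ge0 hchar). Qed.

Let M0_ge0 t i j : 0 <= t -> 0 <= M 0 t i j.
Proof. by move=> t0; apply: (bernstein_semigroup_ge0 hchar). Qed.

Let r t i := \sum_j M 1 t i j.

Lemma measurable_decay_X t : 0 <= t -> measurable_fun setT (fun w => decay (X t w)).
Proof.
by move=> t0; apply: (measurableT_comp (@measurable_decay R K)); exact: (measurable_X hMAP).
Qed.

Lemma integral_decay t i : 0 <= t ->
  (\int[P 0 i]_w (decay (X t w))%:E = (\sum_j M 1 t i j)%:E)%E.
Proof.
move=> t0.
rewrite (ge0_integral_types hMAP hchar hkill hp i t0); last 2 first.
- by apply/measurable_EFinP; exact: measurable_decay_X.
- by move=> w; rewrite lee_fin decay_ge0.
rewrite -sumEFin; apply: eq_bigr => j _.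
rewrite -(laplace_transform hchar)//; apply: eq_integral => w.
rewrite inE /type_event /= /type_at /real_position mul1r.
by case: (X t w) => [[x k]|].
Qed.

Let decay_mono x i : {ae P x i, forall w, forall s t : R, 0 <= s <= t ->
  decay (X t w) <= decay (X s w)}.
Proof.
apply: filterS (hmono x i) => w mono s t st; have := mono s t st.
rewrite /position_at; case: (X s w) => [[y k]|]; case: (X t w) => [[z l]|]//=.
by rewrite lee_fin ler_expR lerN2.
Qed.

Let r_mono s t i : 0 <= s <= t -> r t i <= r s i.
Proof.
move=> /andP[s0 st]; have t0 := le_trans s0 st.
rewrite -lee_fin -!integral_decay//; apply: ae_ge0_le_integral => //.
- by move=> w _; rewrite lee_fin decay_ge0.
- by apply/measurable_EFinP; exact: measurable_decay_X.
- by move=> w _; rewrite lee_fin decay_ge0.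
- by apply/measurable_EFinP; exact: measurable_decay_X.
- by apply: filterS (decay_mono 0 i) => w h _; rewrite lee_fin; apply: h; rewrite s0.
Qed.

Let r_le1 t i : 0 <= t -> r t i <= 1.
Proof.
move=> t0; apply: (@le_trans _ _ (r 0 i)); first by apply: r_mono; rewrite lexx.
rewrite /r bernstein_semigroup0 (bigD1 i)//= mxE eqxx big1 ?addr0// => j ji.
by rewrite mxE eq_sym (negbTE ji).
Qed.

(** If the position never moved when started from the origin, additivity at
    time 0 would make it constant from every starting point. *)
Lemma position_moves : exists i0 (n : nat), \sum_j M 1 n%:R i0 j < 1.
Proof.
apply: contrapT => hno; apply: hnonconst => x i.
have r1 n : \sum_j M 1 n%:R i j = 1.
  apply/eqP; rewrite eq_le (r_le1 i (ler0n _ n)) leNgt; apply/negP => lt1.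
  by apply: hno; exists i, n.
have mD0 : measurable (D 0 i) by exact: (measurable_type_event hMAP).
have start : P x i (D 0 i) = 1%E.
  apply/eqP; rewrite eq_le probability_le1//=.
  rewrite -(map_start hMAP x i); apply: le_measure; rewrite ?inE.
  - rewrite (_ : [set Some (x, i)] = cell [set x] i).
      exact: (map_measurable hMAP).
    by apply/seteqP; split => [_ ->|_ [_ -> ->]]; first by exists x.
  - exact: (measurable_type_event hMAP).
  - by move=> w /=; rewrite /type_event /type_at /= => ->.
have N0 : P x i (~` D 0 i) = 0%E by rewrite probability_setC// start subee.
have stays n : {ae P x i, forall w, decay (shifted X 0 w n%:R) = 1}.
  pose g (f : mpath R K) : \bar R := (decay (f n%:R))%:E.
  have mg : measurable_fun setT g.
    apply/measurable_EFinP; apply: (measurableT_comp (@measurable_decay R K)).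
    exact: measurable_eval.
  have g0 f : (0 <= g f)%E by rewrite lee_fin decay_ge0.
  have mgs : measurable_fun setT (fun w => decay (shifted X 0 w n%:R)).
    apply/measurable_EFinP.
    exact: (measurableT_comp mg (measurable_shifted hMAP (lexx 0))).
  apply: ae_eq1_integral => //.
  - by move=> w; exact: decay_ge0.
  - apply: filterS (hmono x i) => w mono.
    have := mono 0 n%:R; rewrite lexx ler0n => /(_ isT).
    rewrite /shifted add0r /position_at.
    case: (X 0 w) => [[y k]|]//; case: (X n%:R w) => [[z l]|]//=.
    by rewrite lee_fin => yz; rewrite -expR0 ler_expR oppr_le0 subr_ge0.
  - have := @markov_expectation _ _ _ _ _ _ hMAP x i 0 i (cst 1%E) g (lexx 0).
    rewrite /= => /(_ _ mg _ g0) H.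
    have {}H := H (measurable_cst _) (fun _ => lee01).
    have E : (\int[P 0 i]_w g (X ^~ w) = 1)%E.
      by rewrite integral_decay// r1.
    have E1 : (\int[P x i]_(w in D 0 i) cst 1 (xi 0 w) = 1)%E.
      rewrite integral_cst; last exact: (measurable_type_event hMAP).
      by rewrite mul1e; exact: start.
    rewrite E mule1 E1 in H.
    apply: etrans H; under [RHS]eq_integral do rewrite mul1e.
    have mD : measurable (~` D 0 i) by apply: measurableC; exact: (measurable_type_event hMAP).
    rewrite [LHS](ge0_negligible_integral mD)//.
    + by rewrite setTD setCK.
    + exact/measurable_EFinP.
    + by move=> w _; rewrite lee_fin decay_ge0.
have {}stays : {ae P x i, forall w, forall n : nat, decay (shifted X 0 w n%:R) = 1}.
  exact/ae_foralln.
apply: filterS2 stays (hmono x i) => w stays mono t t0.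
have posn n : position_at X n%:R w = position_at X 0 w.
  have := stays n; rewrite /shifted add0r /position_at.
  case: (X 0 w) => [[y k]|]; case: (X n%:R w) => [[z l]|]//=;
    try (by move=> /esym/eqP; rewrite oner_eq0).
  by rewrite -expR0 => /expR_inj/eqP; rewrite oppr_eq0 subr_eq0 => /eqP ->.
apply/eqP; rewrite eq_le; apply/andP; split; last by apply: mono; rewrite lexx.
rewrite -(posn (Num.truncn t).+1); apply: mono.
by rewrite t0 ltW// truncnS_gt.
Qed.


(** Along each edge of a path of positive rates, [expmx (h *: rate c)] has for small
    [h] a positive entry, by its derivative at 0. *)
Lemma type_reachable i i0 : exists s, 0 <= s /\ 0 < M 0 s i i0.
Proof.
have /connectP[p] := hirr i i0.
elim: p i => [|a p ih] i /=.
  move=> _ ->; exists 0; rewrite lexx bernstein_semigroup0 mxE eqxx; split => //.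
move=> /andP[ia ep] lastp.
have [s [s0 Ms]] := ih a ep lastp.
have [h [h0 Mh]] : exists h, 0 <= h /\ 0 < M 0 h i a.
  have := is_derive_expmx (rate c) i a 0; rewrite expmx0 mulmx1 => /is_derive_cvg_right.
  move=> /cvgr_gt-/(_ 0 ia) H.
  have [h [h0 Hh]] : exists h : R, 0 < h /\
      0 < h^-1 * (expmx (h *: rate c) i a - expmx (0 *: rate c) i a).
    have F2 : \forall h \near (0 : R)^'+, 0 < h /\
        0 < h^-1 * (expmx (h *: rate c) i a - expmx (0 *: rate c) i a).
      by apply: filterS2 (nbhs_right_gt 0) H => h h1 h2.
    have [h [h1 h2]] := filter_ex F2.
    by exists h.
  exists h; split; first exact: ltW.
  rewrite (bernstein_semigroup_p0 adm hkill); move: Hh.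
  rewrite pmulr_rgt0 ?invr_gt0// subr_gt0 expmx0; apply: le_lt_trans.
  by rewrite mxE; case: eqP.
exists (h + s); split; first exact: addr_ge0.
rewrite bernstein_semigroupD mxE (bigD1 a)//= ltr_pwDl ?mulr_gt0//.
by apply: sumr_ge0 => j _; rewrite mulr_ge0// M0_ge0.
Qed.

(** [e^-xi] is positive, so that its integral over an event of positive
    probability does not vanish. *)
Lemma bernstein_semigroup_gt0 s i j : 0 <= s -> 0 < M 0 s i j -> 0 < M 1 s i j.
Proof.
move=> s0 Mgt; rewrite lt_neqAle M1_ge0// andbT; apply/negP => /eqP M10.
have mD : measurable (D s j) by exact: (measurable_type_event hMAP).
have mf : measurable_fun (D s j) (fun w => (expR (- (1 * xi s w)))%:E).
  apply/measurable_EFinP; apply: measurableT_comp => //.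
  apply: measurable_funTS; apply: measurableT_comp => //.
  by apply: measurable_funM => //; exact: (measurable_real_position hMAP).
have : (\int[P 0 i]_(w in D s j) `|(expR (- (1 * xi s w)))%:E| = 0)%E.
  transitivity (\int[P 0 i]_(w in D s j) (expR (- (1 * xi s w)))%:E)%E.
    by apply: eq_integral => w _ /=; rewrite ger0_norm// expR_ge0.
  by rewrite (laplace_transform hchar)// -M10.
move/(ae_eq_integral_abs (P 0 i) mD mf) => [N [mN N0 DN]].
have : (P 0 i (D s j) <= P 0 i N)%E.
  apply: le_measure; rewrite ?inE// => w Dw; apply: DN => /= /(_ Dw) [].
  by apply/eqP; rewrite gt_eqF// expR_gt0.
rewrite [X in (_ <= X)%E]N0 (prob_type_event hMAP hchar hp)// lee_fin.
by rewrite leNgt Mgt.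
Qed.

(** The type [i0] in which the position moves is reached from every type, so
    that over a long enough period every type loses a fixed proportion of the
    mean of e^-xi. *)
Lemma uniform_contraction : exists (N : nat) (rho : R),
  [/\ 0 <= rho, rho < 1 & forall i, \sum_j M 1 N.+1%:R i j <= rho].
Proof.
have [i0 [n rn]] := position_moves.
have loses i : exists N : nat, r N.+1%:R i < 1.
  have [s [s0 Ms]] := type_reachable i i0.
  have {}Ms := bernstein_semigroup_gt0 s0 Ms.
  exists (Num.truncn (s + n%:R)).
  have sn : 0 <= s + n%:R <= (Num.truncn (s + n%:R)).+1%:R.
    by rewrite addr_ge0//= ltW// truncnS_gt.
  apply: (le_lt_trans (r_mono i sn)); apply: lt_le_trans (r_le1 i s0).
  have -> : r (s + n%:R) i = \sum_k M 1 s i k * r n%:R k.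
    rewrite /r; under eq_bigr do rewrite bernstein_semigroupD mxE.
    by rewrite exchange_big/=; apply: eq_bigr => k _; rewrite mulr_sumr.
  rewrite /r (bigD1 i0)//= [ltRHS](bigD1 i0)//=; apply: ltr_leD.
    by rewrite gtr_pMr.
  by apply: ler_sum => k _; rewrite ler_piMr ?M1_ge0//; exact: (r_le1 k (ler0n _ n)).
have [f fP] := choice loses.
pose N := \max_i f i; exists N.
pose rho := \big[Num.max/0]_i r N.+1%:R i; exists rho.
have rN i : r N.+1%:R i < 1.
  apply: le_lt_trans (fP i); apply: r_mono.
  by rewrite ler0n ler_nat ltnS leq_bigmax.
split.
- exact: bigmax_ge_id.
- by apply/bigmax_ltP; split.
- by move=> i; exact: le_bigmax.
Qed.

Lemma geometric_decay (N : nat) (rho : R) (k : nat) i : 0 <= rho ->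
  (forall i, \sum_j M 1 N.+1%:R i j <= rho) ->
  \sum_j M 1 (k%:R * N.+1%:R) i j <= rho ^+ k.
Proof.
move=> rho0 H; elim: k i => [|k ih] i.
  by rewrite mul0r expr0; exact: r_le1.
rewrite -natr1 mulrDl mul1r addrC; under eq_bigr do rewrite bernstein_semigroupD mxE.
rewrite exchange_big/=; apply: (@le_trans _ _ (\sum_l M 1 N.+1%:R i l * rho ^+ k)).
  by apply: ler_sum => l _; rewrite -mulr_sumr ler_wpM2l ?M1_ge0.
by rewrite -mulr_suml exprS ler_wpM2r ?exprn_ge0.
Qed.

Lemma measurable_path_functional_X :
  measurable_fun setT (fun w => path_functional (X ^~ w)).
Proof.
exact: (measurableT_comp (@measurable_path_functional R K) (measurable_path hMAP)).
Qed.

Lemma path_functional_ge0 (f : R -> state R K) : (0 <= path_functional f)%E.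
Proof.
apply: (@le_trans _ _ (ereal_sup (range (fun m : nat =>
    (\sum_(k < m) (0.+1)%:R^-1 * decay (f (k.+1%:R * (0.+1)%:R^-1)))%:E)))).
  by apply: ereal_sup_ubound; exists 0%N => //; rewrite big_ord0.
by apply: ereal_sup_ubound; exists 0%N.
Qed.

(** The integral is at most the left Riemann sum with mesh [N.+1], the mean of
    which is dominated by a geometric series of ratio [rho]. *)
Lemma mean_path_functional i : (\int[P 0 i]_w path_functional (X ^~ w) < +oo)%E.
Proof.
have [N [rho [rho0 rho1 H]]] := uniform_contraction.
pose g k w := (N.+1%:R * decay (X (k%:R * N.+1%:R) w))%:E.
have mg k : measurable_fun setT (g k).
  apply/measurable_EFinP; apply: measurable_funM => //.
  by apply: measurable_decay_X; rewrite mulr_ge0.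
have g0 k w : (0 <= g k w)%E by rewrite lee_fin mulr_ge0// decay_ge0.
apply: (@le_lt_trans _ _ (\int[P 0 i]_w \sum_(0 <= k <oo) g k w)%E).
  apply: ae_ge0_le_integral => //.
  - by move=> w _; exact: path_functional_ge0.
  - exact: measurable_path_functional_X.
  - by move=> w _; apply: nneseries_ge0.
  - by apply: ge0_emeasurable_sum.
  - apply: filterS (ae_regular_path hMAP hmono hchar hkill hp i) => w reg _.
    by rewrite -path_integral_functional//; exact: path_integral_le_series.
rewrite integral_nneseries//.
have gE k : (\int[P 0 i]_w g k w <= (N.+1%:R * rho ^+ k)%:E)%E.
  rewrite /g; under eq_integral do rewrite EFinM.
  rewrite ge0_integralZl_EFin//.
  - rewrite integral_decay ?mulr_ge0// -EFinM lee_fin ler_wpM2l//.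
    exact: geometric_decay.
  - by move=> w _; rewrite lee_fin decay_ge0.
  - by apply/measurable_EFinP/measurable_decay_X; rewrite mulr_ge0.
apply: (@le_lt_trans _ _ (\sum_(0 <= k <oo) (N.+1%:R * rho ^+ k)%:E)%E).
  by apply: lee_nneseries => // k _ _; exact: integral_ge0.
have : cvgn (series (geometric N.+1%:R rho)).
  by apply: is_cvg_geometric_series; rewrite ger0_norm.
move=> /cvg_ex[l cl].
have -> : (\sum_(0 <= k <oo) (N.+1%:R * rho ^+ k)%:E = l%:E)%E.
  apply/cvg_lim => //; apply: cvg_EFin; first by near=> n; rewrite sumEFin.
  by rewrite (_ : _ \o _ = series (geometric N.+1%:R rho))//; apply/funext => n /=; rewrite sumEFin.
exact: ltry.
Unshelve. all: by end_near. Qed.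

End FiniteMean.

(** * Real moments of the exponential functional *)

Section Moments.
Context (R : realType) (K : nat) (d : measure_display) (T : measurableType d)
  (P : R -> 'I_K -> probability T R) (X : R -> T -> state R K)
  (c : characteristics R K).
Hypotheses (hMAP : is_MAP P X) (hmono : nondecreasing_position P X)
  (hchar : has_characteristics P X c) (hkill : forall i, killing c i = 0)
  (hp : (underline_p c < 0)%E) (hirr : irreducible_rate (rate c))
  (hnonconst : ~ constant_position P X).

Local Notation M := (bernstein_semigroup c).
Local Notation D := (type_event X).
Local Notation xi := (real_position X).

(** The logarithm of I_xi, up to a null event (see [lne_exp_functional]); unlike
    [exp_functional], it is measurable. *)
Definition log_exp_functional (w : T) : R := log_functional (X ^~ w).
Local Notation Z := log_exp_functional.

Lemma measurable_log_exp_functional : measurable_fun setT Z.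
Proof.
exact: (measurableT_comp (@measurable_log_functional R K) (measurable_path hMAP)).
Qed.

Lemma measurable_log_shifted t : 0 <= t ->
  measurable_fun setT (fun w => log_functional (shifted X t w)).
Proof.
move=> t0.
exact: (measurableT_comp (@measurable_log_functional R K) (measurable_shifted hMAP t0)).
Qed.

Definition good_path (w : T) : Prop :=
  regular_path (X ^~ w) /\ (path_integral (X ^~ w) < +oo)%E.

Lemma ae_good_path i : {ae P 0 i, forall w, good_path w}.
Proof.
have h : (P 0 i).-integrable setT (fun w => path_functional (X ^~ w)).
  apply/integrableP; split; first exact: (measurable_path_functional_X hMAP).
  under eq_integral do rewrite gee0_abs ?path_functional_ge0//.
  exact: (mean_path_functional hMAP hmono hchar).
have := integrable_ae measurableT h.
apply: filterS2 (ae_regular_path hMAP hmono hchar hkill hp i) => w reg /(_ I) fin.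
by split => //; rewrite path_integral_functional// ltey_eq fin.
Qed.

Lemma exp_functional_log w : good_path w -> exp_functional X w = (expR (Z w))%:E.
Proof. by move=> [reg fin]; rewrite exp_functionalE path_integral_log. Qed.

Lemma lne_exp_functional w : good_path w -> lne (exp_functional X w) = (Z w)%:E.
Proof. by move=> g; rewrite exp_functional_log// lne_EFin ?expR_gt0// expRK. Qed.

Definition mom (p : R) (i : 'I_K) : \bar R :=
  (\int[P 0 i]_w (expR (p * Z w))%:E)%E.

Lemma measurable_mom p : measurable_fun setT (fun w => (expR (p * Z w))%:E).
Proof.
by apply/measurable_EFinP/measurable_expRM => //; exact: measurable_log_exp_functional.
Qed.

Lemma momentE p i : moment P X p i = mom p i.
Proof.
apply: ge0_integral_ae_eq.
- by move=> w; exact: expeR_ge0.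
- by move=> w; rewrite lee_fin expR_ge0.
- exact: measurable_mom.
- by apply: filterS (ae_good_path i) => w g; rewrite lne_exp_functional.
Qed.

Lemma integral_lne_exp_functional i :
  (\int[P 0 i]_w lne (exp_functional X w) = \int[P 0 i]_w (Z w)%:E)%E.
Proof.
apply: integral_eq_ae_measurable.
- by apply/measurable_EFinP; exact: measurable_log_exp_functional.
- by apply: filterS (ae_good_path i) => w g; rewrite lne_exp_functional.
Qed.

Lemma mom_ge0 p i : (0 <= mom p i)%E.
Proof. by apply: integral_ge0 => w _; rewrite lee_fin expR_ge0. Qed.

(** E_i[e^(-p xi_t) I'^q], for the exponential functional I' of the process shifted
    to time [t]: given the type at time [t], the two factors are independent. *)
Lemma markov_mom p q t i : (underline_p c < p%:E)%E -> 0 <= t ->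
  (\int[P 0 i]_w (expR (- (p * xi t w)) * expR (q * log_functional (shifted X t w)))%:E
   = \sum_j (M p t i j)%:E * mom q j)%E.
Proof.
move=> pp t0.
have m1 : measurable_fun setT (fun y : R => (expR (- (p * y)))%:E).
  under eq_fun do rewrite -mulNr.
  by apply/measurable_EFinP/measurable_expRM.
have m2 : measurable_fun setT (fun f : mpath R K => (expR (q * log_functional f))%:E).
  by apply/measurable_EFinP/measurable_expRM => //; exact: measurable_log_functional.
rewrite (ge0_integral_types hMAP hchar hkill hp i t0); last 2 first.
- under eq_fun do rewrite EFinM; apply: emeasurable_funM.
    by apply: (measurableT_comp m1); exact: (measurable_real_position hMAP).
  by apply: (measurableT_comp m2); exact: (measurable_shifted hMAP).
- by move=> w; rewrite lee_fin mulr_ge0 ?expR_ge0.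
apply: eq_bigr => j _; under eq_integral do rewrite EFinM.
have f0 (y : R) : (0 <= (expR (- (p * y)))%:E)%E by rewrite lee_fin expR_ge0.
have g0 (f : mpath R K) : (0 <= (expR (q * log_functional f))%:E)%E.
  by rewrite lee_fin expR_ge0.
have H := markov_expectation hMAP 0 i j t0 m1 m2 f0 g0.
rewrite [LHS]H; congr (_ * _)%E.
exact: (laplace_transform hchar).
Qed.

(** I_xi is at least e^-xi_1, whose [p]-th power has finite mean for [p] above
    [underline_p c]. *)
Lemma mom_neg_fin p i : (underline_p c < p%:E)%E -> p < 0 -> (mom p i < +oo)%E.
Proof.
move=> pp p0.
have mf : measurable_fun setT (fun w => (expR (- (p * xi 1 w)))%:E).
  under eq_fun do rewrite -mulNr.
  by apply/measurable_EFinP/measurable_expRM => //; exact: (measurable_real_position hMAP).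
apply: (@le_lt_trans _ _ (\int[P 0 i]_w (expR (- (p * xi 1 w)))%:E)%E).
  apply: ae_ge0_le_integral => //.
  - exact: measurable_mom.
  apply: filterS (ae_good_path i) => w [reg fin] _.
  rewrite lee_fin ler_expR -mulrN ler_wnM2l ?(ltW p0)// -ler_expR.
  have := log_tail_diff reg fin (s := 0) (t := 1).
  rewrite lexx ler01 subr0 mul1r log_tail0// => /(_ isT) /andP[+ _].
  move/le_trans; apply; rewrite lerBlDr lerDl; exact: expR_ge0.
rewrite (ge0_integral_types hMAP hchar hkill hp i ler01)//.
rewrite (eq_bigr (fun j => (M p 1 i j)%:E)); last first.
  by move=> j _; rewrite (laplace_transform hchar).
by rewrite sumEFin ltry.
Qed.

Lemma mom1_fin i : (mom 1 i < +oo)%E.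
Proof.
rewrite (_ : mom 1 i = \int[P 0 i]_w path_functional (X ^~ w))%E.
  exact: (mean_path_functional hMAP hmono hchar).
apply/esym/ge0_integral_ae_eq.
- by move=> w; exact: path_functional_ge0.
- by move=> w; rewrite lee_fin expR_ge0.
- exact: measurable_mom.
- apply: filterS (ae_good_path i) => w [reg fin].
  by rewrite mul1r -path_integral_functional// path_integral_log.
Qed.

Lemma mom0 i : mom 0 i = 1%E.
Proof.
rewrite /mom; under eq_integral do rewrite mul0r expR0.
by rewrite (integral_cst _ _ 1)// mul1e; exact: probability_setT.
Qed.

Lemma integrable_mom p i : (mom p i < +oo)%E ->
  (P 0 i).-integrable setT (EFin \o (fun w => expR (p * Z w))).
Proof.
move=> fin; apply/integrableP; split; first exact: measurable_mom.
by under eq_integral do rewrite /= ger0_norm ?expR_ge0//.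
Qed.

Lemma mom_fin_between a b p i : a <= p <= b ->
  (mom a i < +oo)%E -> (mom b i < +oo)%E -> (mom p i < +oo)%E.
Proof.
move=> apb /integrable_mom ia /integrable_mom ib.
have /integrableP[_] := integrable_expRM measurableT measurable_log_exp_functional apb ia ib.
by under eq_integral do rewrite /= ger0_norm ?expR_ge0//.
Qed.

Lemma fin_num_mom p i : (mom p i < +oo)%E -> mom p i \is a fin_num.
Proof. by move=> h; rewrite ge0_fin_numE// mom_ge0. Qed.

End Moments.

(** * Lower limits and increments of powers *)

Section LowerLimits.
Context (R : realType).
Implicit Types (u v : (\bar R)^nat) (l : \bar R).
Local Open Scope ereal_scope.

Lemma limn_einf_le_cvg u v l : (forall n, u n <= v n) -> v n @[n --> \oo] --> l ->
  limn_einf u <= l.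
Proof.
move=> uv vl; rewrite -(cvg_lim _ vl)// limn_einf_lim.
apply: lee_lim; [exact: is_cvg_einfs|by apply/cvg_ex; exists l|].
near=> n; apply: le_trans (uv n).
by apply: ereal_inf_lbound; exists n => //=.
Unshelve. all: by end_near. Qed.

Lemma limn_einf_ge_cvg u v l : (forall n, v n <= u n) -> v n @[n --> \oo] --> l ->
  l <= limn_einf u.
Proof.
move=> vu vl; rewrite -(cvg_lim _ vl)// -is_cvg_limn_einfE; last by apply/cvg_ex; exists l.
rewrite !limn_einf_lim; apply: lee_lim; [exact: is_cvg_einfs|exact: is_cvg_einfs|].
near=> n; apply: le_ereal_inf_tmp => _ [m mn <-]; apply: le_trans (vu m).
by apply: ereal_inf_lbound; exists m.
Unshelve. all: by end_near. Qed.

End LowerLimits.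

Section PowerIncrements.
Context (R : realType).

(** The convex function [a |-> a^p], for [p <= 0], lies above its tangents;
    here it is written in the logarithmic variable. *)
Lemma expR_tangent (p x y : R) : p <= 0 ->
  expR (p * x) + p * expR ((p - 1) * x) * (expR y - expR x) <= expR (p * y).
Proof.
move=> p0.
have -> : expR (p * y) = expR (p * x) * expR (p * (y - x)).
  by rewrite -expRD; congr expR; ring.
have -> : expR ((p - 1) * x) = expR (p * x) * expR (- x).
  by rewrite -expRD; congr expR; ring.
have -> : expR y = expR x * expR (y - x) by rewrite -expRD; congr expR; ring.
have h1 : 1 + p * (y - x) <= expR (p * (y - x)) by exact: expR_ge1Dx.
have h2 : 1 + (y - x) <= expR (y - x) by exact: expR_ge1Dx.
have h3 : expR (- x) * expR x = 1 by rewrite -expRD addNr expR0.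
have -> : expR (p * x) + p * (expR (p * x) * expR (- x)) *
   (expR x * expR (y - x) - expR x) =
   expR (p * x) * (1 + p * (expR (- x) * expR x) * (expR (y - x) - 1)) by ring.
rewrite h3 mulr1 ler_wpM2l ?expR_ge0//; apply: le_trans h1.
by rewrite lerD2l ler_wnM2l//; lra.
Qed.

(** With [A = expR L], the increments of [A^p] are bounded by left Riemann sums of
    [- p int A^(p-1) e^-x] up to a telescoping error, because [A^(p-1)] is
    nondecreasing along the sequence. *)
Lemma power_riemann_bound (p delta : R) (L x : nat -> R) : p <= 0 -> 0 <= delta ->
  (forall k, 0 <= x k) ->
  (forall k, 0 <= expR (L k) - expR (L k.+1) <= delta * expR (- x k)) ->
  forall m, expR (p * L m) <= expR (p * L 0%N) +
    - p * delta * (\sum_(k < m) expR ((p - 1) * L k) * expR (- x k) +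
                   (expR ((p - 1) * L m) - expR ((p - 1) * L 0%N))).
Proof.
move=> p0 d0 x0 HL; elim=> [|m ih].
  by rewrite big_ord0 subrr addr0 mulr0 addr0.
have /andP[l1 l2] := HL m.
have tg := expR_tangent (L m.+1) (L m) p0.
have ex : expR (- x m) <= 1 by rewrite -expR0 ler_expR oppr_le0.
have Lm : expR ((p - 1) * L m) <= expR ((p - 1) * L m.+1).
  rewrite ler_expR ler_wnM2l//; first by lra.
  by rewrite -ler_expR -subr_ge0.
rewrite big_ord_recr/=.
set a := expR ((p - 1) * L m) in ih tg Lm *.
set b := expR ((p - 1) * L m.+1) in ih tg Lm *.
set g := expR (L m) - expR (L m.+1) in l1 l2 tg.
have a0 : 0 <= a by exact: expR_ge0.
(* the tangent is taken at the new point, where [A^(p-1)] is larger; the excess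
   [b - a] is what telescopes *)
have step : expR (p * L m.+1) - expR (p * L m) <= - p * (b * g) by move: tg; lra.
have bg : b * g <= delta * (a * expR (- x m)) + delta * (b - a).
  have -> : b * g = a * g + (b - a) * g by ring.
  apply: lerD; first by rewrite mulrCA ler_wpM2l.
  rewrite [leRHS]mulrC ler_wpM2l ?subr_ge0//; apply: (le_trans l2).
  by rewrite ler_piMr.
have : - p * (b * g) <= - p * (delta * (a * expR (- x m)) + delta * (b - a)).
  by rewrite ler_wpM2l// oppr_ge0.
move: ih step; set S := \sum_(_ < _) _; lra.
Qed.

End PowerIncrements.

(** * The recurrence between moments *)

Section Recurrence.
Context (R : realType) (K : nat) (d : measure_display) (T : measurableType d)
  (P : R -> 'I_K -> probability T R) (X : R -> T -> state R K)
  (c : characteristics R K).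
Hypotheses (hMAP : is_MAP P X) (hmono : nondecreasing_position P X)
  (hchar : has_characteristics P X c) (hkill : forall i, killing c i = 0)
  (hp : (underline_p c < 0)%E) (hirr : irreducible_rate (rate c))
  (hnonconst : ~ constant_position P X).

Local Notation M := (bernstein_semigroup c).
Local Notation D := (type_event X).
Local Notation xi := (real_position X).
Local Notation Z := (log_exp_functional X).
Local Notation mom := (mom P X).

Let good i := ae_good_path hMAP hmono hchar hkill hp hirr hnonconst i.

Definition mom_vec (p : R) : 'cV[R]_K := \col_i fine (mom p i).

Variable p : R.
Hypotheses (pp : (underline_p c < p%:E)%E) (p0 : p < 0).

Let mom_fin i : mom p i \is a fin_num.
Proof. exact/fin_num_mom/(mom_neg_fin hMAP hmono hchar). Qed.

(** E_i[A_t^p] in terms of the semigroup, as A_t is e^-xi_t times the exponential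
    functional of the shifted process. *)
Let integral_log_tail t i : 0 <= t ->
  (\int[P 0 i]_w (expR (p * log_tail (X ^~ w) t))%:E = ((M p t *m mom_vec p) i 0)%:E)%E.
Proof.
move=> t0; have := markov_mom hMAP hchar hkill hp p i pp t0.
under eq_integral => w _.
  rewrite -expRD (_ : - (p * xi t w) + p * log_functional (shifted X t w) =
    p * log_tail (X ^~ w) t); last first.
    by rewrite /log_tail /real_position /shift_path mulrBr addrC.
  over.
move=> ->; rewrite mxE -sumEFin; apply: eq_bigr => j _.
by rewrite [mom_vec p j 0]mxE EFinM fineK.
Qed.

Let measurable_log_tail t : 0 <= t -> measurable_fun setT (fun w => log_tail (X ^~ w) t).
Proof.
move=> t0; apply: measurable_funB.
  exact: (measurable_log_shifted hMAP t0).
exact: (measurable_real_position hMAP t0).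
Qed.

(** I_xi^q e^-xi_t *)
Let weight q t w : \bar R := (expR (q * Z w) * decay (X t w))%:E.

Let measurable_weight q t : 0 <= t -> measurable_fun setT (weight q t).
Proof.
move=> t0; apply/measurable_EFinP; apply: measurable_funM.
  by apply: measurable_expRM => //; exact: (measurable_log_exp_functional hMAP).
exact: (measurable_decay_X hMAP t0).
Qed.

Let weight_ge0 q t w : (0 <= weight q t w)%E.
Proof. by rewrite lee_fin mulr_ge0 ?expR_ge0 ?decay_ge0. Qed.

(** Convexity gives A_t^p >= I_xi^p - p I_xi^(p-1) (A_0 - A_t), and
    A_0 - A_t >= t e^-xi_t. *)
Let lower_increment t i : 0 < t ->
  (\int[P 0 i]_w weight (p - 1) t w <=
    ((- p)^-1 * (t^-1 * ((M p t *m mom_vec p) i 0 - (M p 0 *m mom_vec p) i 0)))%:E)%E.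
Proof.
move=> t0.
have pN : 0 < - p by rewrite oppr_gt0.
have c0 : (0 <= ((- p) * t)%:E)%E by rewrite lee_fin mulr_ge0// ltW.
have m1 := measurable_mom hMAP p.
have m2 := measurable_weight (p - 1) (ltW t0).
have H : (mom p i + ((- p) * t)%:E * \int[P 0 i]_w weight (p - 1) t w <=
    ((M p t *m mom_vec p) i 0)%:E)%E.
  rewrite -integral_log_tail; last exact: ltW.
  rewrite -ge0_integralZl//.
  rewrite /mom -ge0_integralD//; last 2 first.
  - by move=> w _; exact: mule_ge0.
  - exact: emeasurable_funM.
  apply: ae_ge0_le_integral => //.
  - by move=> w _; apply: adde_ge0; [rewrite lee_fin expR_ge0|exact: mule_ge0].
  - by apply: emeasurable_funD => //; exact: emeasurable_funM.
  - apply/measurable_EFinP/measurable_expRM => //; exact: (measurable_log_tail (ltW t0)).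
  apply: filterS (good i) => w [reg fin] _.
  rewrite /weight -EFinM -EFinD lee_fin.
  have := log_tail_diff reg fin (s := 0) (t := t).
  rewrite lexx (ltW t0) subr0 log_tail0// => /(_ isT) /andP[h1 _].
  have dE : decay (X t w) = expR (- height (X t w)).
    have [alive _ _] := reg; have := alive t (ltW t0).
    by case: (X t w) => [[y k]|].
  apply: le_trans (expR_tangent (Z w) (log_tail (X ^~ w) t) (ltW p0)).
  rewrite dE lerD2l.
  have : 0 <= expR ((p - 1) * Z w) by exact: expR_ge0.
  move: (expR ((p - 1) * Z w)) => e e0.
  have : - p * e * (t * expR (- height (X t w))) <=
      - p * e * (expR (Z w) - expR (log_tail (X ^~ w) t)).
    by rewrite ler_wpM2l// mulr_ge0// ltW.
  by move: (expR (Z w)) (expR (log_tail _ _)) (expR (- height _)) => ? ? ?; lra.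
rewrite bernstein_semigroup0 mul1mx [mom_vec p i 0]mxE.
have wfin : (\int[P 0 i]_w weight (p - 1) t w)%E \is a fin_num.
  rewrite ge0_fin_numE; last by apply: integral_ge0 => w _; exact: weight_ge0.
  rewrite ltey; apply/eqP => E; move: H; rewrite E gt0_muley ?lte_fin ?mulr_gt0//.
  by rewrite -(fineK (mom_fin i)).
move: H; rewrite -(fineK wfin) -(fineK (mom_fin i)) -EFinM -EFinD !lee_fin => H.
rewrite ler_pdivlMl// ler_pdivlMl//.
rewrite lerBrDl; apply: le_trans H; rewrite lerD2l.
by rewrite le_eqVlt; apply/orP; left; apply/eqP; ring.
Qed.

Let derive_u i : is_derive (0 : R) 1 (fun t => (M p t *m mom_vec p) i 0)
  (- (Phi c p *m mom_vec p) i 0).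
Proof.
have -> : (fun t => (M p t *m mom_vec p) i 0) =
    \sum_(k < K) (fun t => M p t i k * mom_vec p k 0).
  by apply/funext => s; rewrite mxE fct_sumE.
have -> : - (Phi c p *m mom_vec p) i 0 =
    \sum_(k < K) (- Phi c p i k * mom_vec p k 0).
  by rewrite mxE -sumrN; apply: eq_bigr => k _; rewrite mulNr.
apply: is_derive_sum => k.
have := is_derive_expmx (- Phi c p) i k 0; rewrite expmx0 mulmx1 => dM.
have := is_deriveM dM (is_derive_cst (mom_vec p k 0) (0 : R) (1 : R)).
by rewrite scaler0 add0r [_ *: (_ : R)]mulrC [(- Phi c p) i k]mxE.
Qed.

Let quot_cvg i : h^-1 * ((M p h *m mom_vec p) i 0 - (M p 0 *m mom_vec p) i 0)
  @[h --> 0^'+] --> - (Phi c p *m mom_vec p) i 0.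
Proof. exact: is_derive_cvg_right (derive_u i). Qed.

Let quot_cvg_seq i : (n.+1%:R^-1)^-1 * ((M p n.+1%:R^-1 *m mom_vec p) i 0 -
  (M p 0 *m mom_vec p) i 0) @[n --> \oo] --> - (Phi c p *m mom_vec p) i 0.
Proof.
have /cvg_at_rightP H := @quot_cvg i; apply: H.
split; first by move=> n; rewrite invr_gt0.
exact: cvg_harmonic.
Qed.

(** Fatou's lemma as [t] decreases to 0: the position is right-continuous at 0, so
    that [e^-xi_t] tends to 1. *)
Lemma mom_recurrence_le i :
  (mom (p - 1) i <= ((- p)^-1 * - (Phi c p *m mom_vec p) i 0)%:E)%E.
Proof.
pose f n w := weight (p - 1) n.+1%:R^-1 w.
have t0 n : 0 < n.+1%:R^-1 :> R by rewrite invr_gt0.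
have -> : mom (p - 1) i = (\int[P 0 i]_w limn_einf (f^~ w))%E.
  apply/esym; apply: ge0_integral_ae_eq.
  - move=> w; apply: (@limn_einf_ge_cvg _ _ (cst 0%E)); last exact: cvg_cst.
    by move=> n; exact: weight_ge0.
  - by move=> w; rewrite lee_fin expR_ge0.
  - exact: (measurable_mom hMAP).
  apply: filterS2 (good i) (ae_start hMAP i) => w [[alive _ _] _] start.
  have cf : f n w @[n --> \oo] --> (expR ((p - 1) * Z w))%:E.
    rewrite /f /weight; apply: cvg_EFin; first by near=> n.
    rewrite -[X in _ --> X]mulr1; apply: cvgM; first exact: cvg_cst.
    have [+ _] := map_right_continuous hMAP w (lexx 0).
    rewrite [position_at X 0 w]/position_at start => /fine_cvgP[posfin posc].
    have decc : decay (X s w) @[s --> 0^'+] --> (1 : R).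
      have : expR (- fine (position_at X s w)) @[s --> 0^'+] --> expR (- 0).
        by apply: continuous_cvg; [exact: continuous_expR|exact: cvgN].
      rewrite oppr0 expR0; apply: cvg_trans; apply: near_eq_cvg.
      near=> s; have : position_at X s w \is a fin_num by near: s; exact: posfin.
      by rewrite /position_at; case: (X s w) => [[y k]|].
    have /cvg_at_rightP H := decc; apply: H.
    split; first by move=> n; exact: t0.
    exact: cvg_harmonic.
  by rewrite is_cvg_limn_einfE ?(cvg_lim _ cf)//; apply/cvg_ex; exists (expR ((p - 1) * Z w))%:E.
have mf n : measurable_fun setT (f n) by apply: measurable_weight; exact: ltW.
have f0 n w : setT w -> (0 <= f n w)%E by move=> _; exact: weight_ge0.
apply: (le_trans (fatou (P 0 i) measurableT mf f0)).
apply: (@limn_einf_le_cvg _ _ (fun n => ((- p)^-1 * ((n.+1%:R^-1)^-1 *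
  ((M p n.+1%:R^-1 *m mom_vec p) i 0 - (M p 0 *m mom_vec p) i 0)))%:E)).
  by move=> n; exact: lower_increment.
apply: cvg_EFin; first by near=> n.
by apply: cvgM; [exact: cvg_cst|exact: quot_cvg_seq].
Unshelve. all: by end_near. Qed.

(** Finiteness of the moments thus propagates one unit to the left. *)
Lemma mom_pred_fin i : mom (p - 1) i \is a fin_num.
Proof. by apply: fin_num_mom; apply: le_lt_trans (mom_recurrence_le i) _; rewrite ltry. Qed.

(** E_i[A_s^(p-1) e^-xi_s]: the factor e^-xi_s turns the power p - 1 of e^-xi_s in
    A_s^(p-1) into the power p, so that the semigroup with parameter [p] appears. *)
Let integral_weight_shifted s i : 0 <= s ->
  (\int[P 0 i]_w (expR ((p - 1) * log_tail (X ^~ w) s) * expR (- xi s w))%:E =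
   ((M p s *m mom_vec (p - 1)) i 0)%:E)%E.
Proof.
move=> s0; have := markov_mom hMAP hchar hkill hp (p - 1) i pp s0.
under eq_integral => w _.
  rewrite (_ : expR (- (p * xi s w)) * expR ((p - 1) * log_functional (shifted X s w)) =
    expR ((p - 1) * log_tail (X ^~ w) s) * expR (- xi s w)); last first.
    by rewrite -!expRD; congr expR; rewrite /log_tail /real_position /shift_path; ring.
  over.
move=> ->; rewrite mxE -sumEFin; apply: eq_bigr => j _.
by rewrite [mom_vec (p - 1) j 0]mxE EFinM fineK// mom_pred_fin.
Qed.

(** By [power_riemann_bound] with mesh [t/(n+1)], and Fatou's lemma as [n] tends to
    infinity, when the telescoping error vanishes. *)
Let upper_increment t i (B : R) : 0 <= t ->
  (forall s, 0 <= s <= t -> (M p s *m mom_vec (p - 1)) i 0 <= B) ->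
  (M p t *m mom_vec p) i 0 - (M p 0 *m mom_vec p) i 0 <= - p * t * B.
Proof.
move=> t0 HB; have pN : 0 <= - p by rewrite oppr_ge0 ltW.
pose delta n : R := t / n.+1%:R.
have d0 n : 0 <= delta n by rewrite divr_ge0.
pose L n (k : nat) w := log_tail (X ^~ w) (k%:R * delta n).
pose S n w := \sum_(k < n.+1) expR ((p - 1) * L n k w) * expR (- xi (k%:R * delta n) w).
pose F n w : \bar R := ((expR (p * Z w))%:E + (- p * delta n)%:E * (S n w)%:E)%E.
pose g w : \bar R := (expR (p * log_tail (X ^~ w) t))%:E.
have kd n k : 0 <= k%:R * delta n by rewrite mulr_ge0.
have mL n k : measurable_fun setT (L n k) by exact: measurable_log_tail.
have mS n : measurable_fun setT (S n).
  apply: measurable_sum => k; apply: measurable_funM; first exact: measurable_expRM.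
  apply: measurableT_comp => //; apply: measurableT_comp => //.
  exact: (measurable_real_position hMAP).
have S0 n w : 0 <= S n w by apply: sumr_ge0 => k _; rewrite mulr_ge0 ?expR_ge0.
have mF n : measurable_fun setT (F n).
  apply: emeasurable_funD; first exact: (measurable_mom hMAP).
  by apply: emeasurable_funM => //; exact/measurable_EFinP.
have F0 n w : (0 <= F n w)%E.
  by apply: adde_ge0; [rewrite lee_fin expR_ge0|apply: mule_ge0; rewrite lee_fin// mulr_ge0].
have mg : measurable_fun setT g.
  by apply/measurable_EFinP/measurable_expRM => //; exact: measurable_log_tail.
have g0 w : (0 <= g w)%E by rewrite lee_fin expR_ge0.
have gF : (\int[P 0 i]_w g w <= \int[P 0 i]_w limn_einf (F ^~ w))%E.
  apply: ae_ge0_le_integral => //.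
  - move=> w _; apply: (@limn_einf_ge_cvg _ _ (cst 0%E)); last exact: cvg_cst.
    by move=> n; exact: F0.
  - apply: measurableT_comp => //.
    apply: (@measurable_fun_limn_esup _ _ _ setT (fun n w => - F n w)%E) => n.
    exact: measurableT_comp.
  apply: filterS (good i) => w [reg fin] _.
  pose C := expR ((p - 1) * log_tail (X ^~ w) t) - expR ((p - 1) * Z w).
  apply: (@limn_einf_ge_cvg _ _ (fun n => (expR (p * log_tail (X ^~ w) t) -
      - p * delta n * C)%:E)) => [n|].
    rewrite /F -EFinM -EFinD lee_fin lerBlDr.
    have := @power_riemann_bound R p (delta n) (fun k => log_tail (X ^~ w) (k%:R * delta n))
      (fun k => height (X (k%:R * delta n) w)) (ltW p0) (d0 n) _ _ n.+1.
    have Et : n.+1%:R * delta n = t by rewrite /delta mulrC divfK// pnatr_eq0.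
    rewrite Et mul0r log_tail0// => H.
    rewrite -addrA -mulrDr; apply: H => k.
      have [_ mono h0] := reg; rewrite -h0; apply: mono.
      by rewrite lexx kd.
    have kk : 0 <= k%:R * delta n <= k.+1%:R * delta n.
      by rewrite kd/= ler_wpM2r// ler_nat.
    have := log_tail_diff reg fin kk.
    rewrite (_ : k.+1%:R * delta n - k%:R * delta n = delta n); last first.
      by rewrite -natr1; ring.
    move=> /andP[l1 ->]; rewrite andbT; apply: le_trans l1.
    by rewrite mulr_ge0// expR_ge0.
  apply: cvg_EFin; first by near=> n.
  rewrite -[X in _ --> X]subr0; apply: cvgB; first exact: cvg_cst.
  rewrite -[X in _ --> X](mul0r C); apply: cvgM; last exact: cvg_cst.
  rewrite -[X in _ --> X](mulr0 (- p)); apply: cvgM; first exact: cvg_cst.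
  rewrite -[X in _ --> X](mulr0 t); apply: cvgM; first exact: cvg_cst.
  exact: cvg_harmonic.
have IF n : (\int[P 0 i]_w F n w <= (fine (mom p i) + - p * t * B)%:E)%E.
  have mm := measurable_mom hMAP p.
  have mSE : measurable_fun setT (fun w => (S n w)%:E) by exact/measurable_EFinP.
  have c0 : (0 <= (- p * delta n)%:E)%E by rewrite lee_fin mulr_ge0.
  have SE0 w : (0 <= (S n w)%:E)%E by rewrite lee_fin.
  have cS0 w : (0 <= (- p * delta n)%:E * (S n w)%:E)%E by exact: mule_ge0.
  have mcS : measurable_fun setT (fun w => (- p * delta n)%:E * (S n w)%:E)%E.
    exact: emeasurable_funM.
  rewrite /F ge0_integralD// EFinD (fineK (mom_fin i)) leeD2l// ge0_integralZl//.
  have -> : (\int[P 0 i]_w (S n w)%:E = (\sum_(k < n.+1) (M p (k%:R * delta n) *m mom_vec (p - 1)) i 0)%:E)%E.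
    rewrite -sumEFin [RHS](eq_bigr (fun k : 'I_n.+1 =>
      (\int[P 0 i]_w (expR ((p - 1) * L n k w) * expR (- xi (k%:R * delta n) w))%:E)%E));
      last by move=> k _; rewrite integral_weight_shifted.
    rewrite -ge0_integral_sum//.
    + by apply: eq_integral => w _; rewrite sumEFin.
    + move=> k; apply/measurable_EFinP; apply: measurable_funM; first exact: measurable_expRM.
      apply: measurableT_comp => //; apply: measurableT_comp => //.
      exact: (measurable_real_position hMAP).
  rewrite -EFinM lee_fin.
  apply: (@le_trans _ _ (- p * delta n * (\sum_(k < n.+1) B))).
    rewrite ler_wpM2l ?mulr_ge0//; apply: ler_sum => k _; apply: HB.
    rewrite kd/= /delta mulrCA ler_piMr// ler_pdivrMr// mul1r ler_nat ltnW//.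
  rewrite sumr_const card_ord -mulr_natr /delta.
  rewrite (_ : - p * (t / n.+1%:R) * (B * n.+1%:R) = - p * t * B)//.
  have n0 : n.+1%:R != 0 :> R by rewrite pnatr_eq0.
  by move: (n.+1%:R : R) n0 => z z0; field.
have : (\int[P 0 i]_w g w <= (fine (mom p i) + - p * t * B)%:E)%E.
  apply: (le_trans gF); apply: le_trans (fatou (P 0 i) measurableT mF (fun n w _ => F0 n w)) _.
  by apply: (limn_einf_le_cvg IF); exact: cvg_cst.
rewrite integral_log_tail// lee_fin bernstein_semigroup0 mul1mx [mom_vec p i 0]mxE.
by rewrite lerBlDl.
Unshelve. all: by end_near. Qed.

(** The relation [Phi(p) N(p) = p N(p-1)] obtained by differentiating at
    [t = 0] the expectation of [(int_t^oo e^-xi_s ds)^p]. *)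
Lemma mom_recurrence : Phi c p *m mom_vec p = p *: mom_vec (p - 1).
Proof.
apply/colP => i; rewrite [RHS]mxE.
pose b := - (Phi c p *m mom_vec p) i 0; pose N1 : R := mom_vec (p - 1) i 0.
have pN : 0 < - p by rewrite oppr_gt0.
have h1 : - p * N1 <= b.
  have := mom_recurrence_le i; rewrite -(fineK (mom_pred_fin i)) lee_fin.
  by rewrite ler_pdivlMl// /N1 [mom_vec _ _ _]mxE.
have h2 : b <= - p * N1.
  apply/ler_addgt0Pr => e e0.
  pose v s := (M p s *m mom_vec (p - 1)) i 0.
  have cv : v s @[s --> 0] --> v 0.
    have -> : v = fun s => \sum_k M p s i k * mom_vec (p - 1) k 0.
      by apply/funext => s; rewrite /v mxE.
    apply: cvg_sum_real => k; apply: cvgM; last exact: cvg_cst.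
    exact: (@continuous_expmx R K _ i k 0).
  have e1 : 0 < e / - p by rewrite divr_gt0.
  have v0 : v 0 = N1 by rewrite /v bernstein_semigroup0 mul1mx.
  have [r r0 Hr] : exists2 r, 0 < r & forall s, 0 <= s < r -> v s <= N1 + e / - p.
    have := cvgr_le _ cv (N1 + e / - p); rewrite v0 ltrDl => /(_ _ e1) [r /= r0 Hr].
    exists r => // s /andP[s0 sr]; apply: Hr => /=.
    by rewrite sub0r normrN ger0_norm.
  apply: (cvgr_to_le (@quot_cvg i)).
  near=> h.
  have h0 : 0 < h by near: h; exact: nbhs_right_gt.
  have hr : h < r by near: h; exact: nbhs_right_lt.
  rewrite ler_pdivrMl//.
  apply: le_trans (@upper_increment h i (N1 + e / - p) (ltW h0) _) _.
    by move=> s /andP[s0 sh]; apply: Hr; rewrite s0 (le_lt_trans sh).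
  rewrite le_eqVlt; apply/orP; left; apply/eqP.
  by field; rewrite lt_eqF.
have E : b = - p * N1 by apply/eqP; rewrite eq_le h2.
by move/(congr1 -%R): E; rewrite /b opprK mulNr opprK.
Unshelve. all: by end_near. Qed.

End Recurrence.

(** * The moment of order -1 *)

Section DerivativeAtZero.
Context (R : realType) (K : nat) (d : measure_display) (T : measurableType d)
  (P : R -> 'I_K -> probability T R) (X : R -> T -> state R K)
  (c : characteristics R K).
Hypotheses (hMAP : is_MAP P X) (hmono : nondecreasing_position P X)
  (hchar : has_characteristics P X c) (hkill : forall i, killing c i = 0)
  (hp : (underline_p c < 0)%E) (hirr : irreducible_rate (rate c))
  (hnonconst : ~ constant_position P X).

Local Notation M := (bernstein_semigroup c).
Local Notation Z := (log_exp_functional X).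
Local Notation mom := (mom P X).
Local Notation N := (mom_vec P X).

Let adm : admissible c. Proof. by case: hchar. Qed.

Lemma negative_parameter : exists p : R, (underline_p c < p%:E)%E /\ p < 0.
Proof.
have [q uq q0] : exists2 q : R, (underline_p c <= q%:E)%E & q < 0.
  have /ereal_inf_ltP[y [q h <-]] := hp; rewrite lte_fin => q0.
  by exists q => //; apply: ereal_inf_lbound; exists q.
exists (q / 2); split; last by lra.
by apply: le_lt_trans uq _; rewrite lte_fin; lra.
Qed.

Let mom_negE p i : (underline_p c < p%:E)%E -> p < 0 -> mom p i \is a fin_num.
Proof. by move=> pp p0; apply/fin_num_mom/(mom_neg_fin hMAP hmono hchar). Qed.

Let mom1E i : (mom 1 i < +oo)%E.
Proof. exact: (mom1_fin hMAP hmono hchar). Qed.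

Let mom_vecE i : (fun p : R => N p i 0) =
  (fun p => Rintegral (P 0 i) setT (fun w => expR (p * Z w))).
Proof. by apply/funext => p; rewrite mxE. Qed.

Lemma Nvec_mom p : Nvec P X p = N p.
Proof.
by apply/colP => i; rewrite !mxE (momentE hMAP hmono hchar).
Qed.

Let ltyW (x : \bar R) : x \is a fin_num -> (x < +oo)%E.
Proof. by move/fineK => <-; rewrite ltry. Qed.

Lemma is_derive_mom0 i : is_derive (0 : R) 1 (fun p : R => N p i 0)
  (Rintegral (P 0 i) setT Z).
Proof.
have [p [pp p0]] := negative_parameter.
have p01 : p < 0 < (1 : R) by apply/andP; split.
have := is_derive_mgf measurableT (measurable_log_exp_functional hMAP) p01
  (integrable_mom hMAP (ltyW (mom_negE i pp p0))) (integrable_mom hMAP (mom1E i)).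
rewrite mom_vecE (_ : Rintegral _ _ _ = Rintegral (P 0 i) setT Z)//.
by apply: eq_Rintegral => w _; rewrite mul0r expR0 mulr1.
Qed.

Lemma integral_log_exp_functional i :
  (\int[P 0 i]_w (Z w)%:E = (Rintegral (P 0 i) setT Z)%:E)%E.
Proof.
have [p [pp p0]] := negative_parameter.
have p01 : p < 0 < (1 : R) by apply/andP; split.
have := integrable_Y_mgf measurableT (measurable_log_exp_functional hMAP) p01
  (integrable_mom hMAP (ltyW (mom_negE i pp p0))) (integrable_mom hMAP (mom1E i)).
move=> /(integrable_fin_num measurableT) H.
rewrite /Rintegral fineK//; move: H.
by under eq_integral do rewrite /= mul0r expR0 mulr1.
Qed.

Lemma near0_mom_fin i : \forall p \near (0 : R), mom p i \is a fin_num.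
Proof.
have [p [pp p0]] := negative_parameter.
near=> q; apply/fin_num_mom/(mom_fin_between hMAP (a := p) (b := 1)) => //.
  apply/andP; split; apply: ltW; near: q; first exact: lt_nbhsr.
  exact: lt_nbhsl.
exact: ltyW (mom_negE i pp p0).
Unshelve. all: by end_near. Qed.

(** By [mom_pred_fin] the moments are finite in a neighbourhood of -1. *)
Lemma cvg_mom_pred i : N (p - 1) i 0 @[p --> (0 : R)^'-] --> N (-1) i 0.
Proof.
have [p [pp p0]] := negative_parameter.
have fin1 : (mom (p - 1) i < +oo)%E.
  by apply/ltyW/(mom_pred_fin hMAP hmono hchar).
have fin0 : (mom 0 i < +oo)%E by rewrite mom0 ltry.
have p10 : p - 1 < -1 < (0 : R) by apply/andP; split; lra.
have [dN _] := is_derive_mgf measurableT (measurable_log_exp_functional hMAP) p10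
  (integrable_mom hMAP fin1) (integrable_mom hMAP fin0).
have cN : {for (-1 : R), continuous (fun p : R => N p i 0)}.
  by rewrite mom_vecE; apply/differentiable_continuous/derivable1_diffP.
apply: cvg_at_left_filter.
have cp : p - 1 @[p --> (0 : R)] --> (-1 : R).
  rewrite -[X in _ --> X]sub0r; apply: cvgB; [exact: cvg_id|exact: cvg_cst].
exact: (cvg_comp (fun p : R => p - 1) (fun p : R => N p i 0) cp cN).
Qed.

Lemma mom_minus1_fin i : mom (-1) i \is a fin_num.
Proof.
have [p [pp p0]] := negative_parameter.
apply/fin_num_mom/(mom_fin_between hMAP (a := p - 1) (b := 0)).
- by apply/andP; split; lra.
- by apply/ltyW/(mom_pred_fin hMAP hmono hchar).
- by rewrite mom0 ltry.
Qed.

Definition dPhi0 : 'M[R]_K := \matrix_(i, j) derive1 (fun p : R => Phi c p i j) 0.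

Lemma is_derive_Phi0 i j : is_derive (0 : R) 1 (fun p : R => Phi c p i j) (dPhi0 i j).
Proof.
by rewrite mxE derive1E; apply/derivableP; exact: derivable_Phi0.
Qed.

(** Dividing [Phi(p) N(p) = p N(p-1)] by [p], and letting [p] increase to 0. *)
Lemma mom_minus1 : N (-1) = dPhi0 *m const_mx 1 -
  rate c *m (\col_i derive1 (fun p : R => N p i 0) 0).
Proof.
apply/colP => i.
pose phi (p : R) := (Phi c p *m N p) i 0.
pose l := (dPhi0 *m const_mx 1 - rate c *m (\col_i derive1 (fun p : R => N p i 0) 0)) i 0.
have N0 j : N 0 j 0 = 1 by rewrite mxE mom0.
have phi0 : phi 0 = 0.
  rewrite /phi Phi0E// mxE.
  under eq_bigr do rewrite N0 mulr1 [(- rate c) _ _]mxE.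
  by rewrite sumrN (rate_row adm) oppr0.
have dphi : is_derive (0 : R) 1 phi l.
  have -> : phi = \sum_(k < K) (fun p => Phi c p i k * N p k 0).
    by apply/funext => s; rewrite /phi mxE fct_sumE.
  have -> : l = \sum_(k < K) (Phi c 0 i k * (Rintegral (P 0 k) setT Z) + N 0 k 0 * dPhi0 i k).
    rewrite /l [LHS]mxE [X in X + _]mxE [X in _ + X]mxE [X in _ - X]mxE.
    rewrite -sumrN -big_split/=; apply: eq_bigr => k _.
    rewrite N0 Phi0E// [(- rate c) _ _]mxE [const_mx _ _ _]mxE mxE derive1E.
    by have [_ ->] := is_derive_mom0 k; ring.
  apply: is_derive_sum => k.
  exact: (is_deriveM (is_derive_Phi0 i k) (is_derive_mom0 k)).
have q1 : h^-1 * (phi h - phi 0) @[h --> (0 : R)^'-] --> l.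
  have [dp <-] := dphi.
  apply: cvg_dnbhs_at_left.
  have : h^-1 *: ((phi \o shift 0) (h *: (1 : R)) - phi 0) @[h --> 0^'] --> 'D_1 phi 0.
    exact: dp.
  apply: cvg_trans; apply: near_eq_cvg; near=> h.
  by rewrite /= addr0 [_ *: 1]mulr1.
have q2 : h^-1 * (phi h - phi 0) @[h --> (0 : R)^'-] --> N (-1) i 0.
  have := @cvg_mom_pred i; apply: cvg_trans; apply: near_eq_cvg.
  have [p [pp p0]] := negative_parameter.
  near=> h.
  have h0 : h < 0 by near: h; exact: nbhs_left_lt.
  have ph : (underline_p c < h%:E)%E.
    apply: (lt_trans pp); rewrite lte_fin; near: h; exact: nbhs_left_gt.
  rewrite phi0 subr0 /phi.
  have -> : Phi c h *m N h = h *: N (h - 1).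
    exact: (mom_recurrence hMAP hmono hchar).
  by rewrite [X in _ * X]mxE mulKf// lt_eqF.
exact: (cvg_unique _ q2 q1).
Unshelve. all: by end_near. Qed.

End DerivativeAtZero.

(** * The mean position *)

Lemma is_derive_cvg_harmonic (R : realType) (f : R -> R) (l : R) :
  is_derive (0 : R) 1 f l ->
  n.+1%:R * (f n.+1%:R^-1 - f 0) @[n --> \oo] --> l.
Proof.
move=> /is_derive_cvg_right/cvg_at_rightP H.
have -> : (fun n => n.+1%:R * (f n.+1%:R^-1 - f 0)) =
    (fun n => (n.+1%:R^-1)^-1 * (f n.+1%:R^-1 - f 0)).
  by apply/funext => n; rewrite invrK.
apply: (H (fun n => n.+1%:R^-1)).
by split=> [n|]; [rewrite invr_gt0|exact: cvg_harmonic].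
Qed.

(** [expmxB_le] in terms of [- F] and [- G], with absolute row sums written out: the
    instances below have Bernstein matrices for [F] and [G]. *)
Lemma expmxNB_le (R : realType) (K : nat) (F G : 'M[R]_K) (b d t : R) :
  0 <= b -> 0 <= d -> 0 <= t ->
  (forall k, \sum_l `|F k l| <= b) -> (forall k, \sum_l `|G k l| <= b) ->
  (forall k, \sum_l `|F k l - G k l| <= d) ->
  forall i j, `|expmx (t *: - F) i j - expmx (t *: - G) i j + t * (F i j - G i j)|
    <= d * t * (expR (t * b) - 1).
Proof.
move=> b0 d0 t0 Fb Gb FGd i j.
have NE (H : 'M[R]_K) k l : (- H) k l = - H k l by rewrite mxE.
have BE k l : (- F - - G) k l = - (F k l - G k l) by rewrite !mxE; ring.
have rF : row_bound (- F) b.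
  by move=> k; under eq_bigr do rewrite NE normrN; exact: Fb.
have rG : row_bound (- G) b.
  by move=> k; under eq_bigr do rewrite NE normrN; exact: Gb.
have rFG : row_bound (- F - - G) d.
  by move=> k; under eq_bigr do rewrite BE normrN; exact: FGd.
by have := expmxB_le b0 d0 t0 rF rG rFG i j; rewrite BE mulrN opprK.
Qed.

Section MeanPosition.
Context (R : realType) (K : nat) (d : measure_display) (T : measurableType d)
  (P : R -> 'I_K -> probability T R) (X : R -> T -> state R K)
  (c : characteristics R K).
Hypotheses (hMAP : is_MAP P X)
  (hchar : has_characteristics P X c) (hkill : forall i, killing c i = 0)
  (hp : (underline_p c < 0)%E).

Local Notation M := (bernstein_semigroup c).
Local Notation D := (type_event X).
Local Notation xi := (real_position X).

Let adm : admissible c. Proof. by case: hchar. Qed.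

Lemma integral_positionE t i j :
  (\int[P 0 i]_(w in [set w | type_at X t w = Some j]) position_at X t w =
   \int[P 0 i]_(w in D t j) (xi t w)%:E)%E.
Proof.
apply: eq_integral => w; rewrite inE /type_event /= /type_at /position_at /real_position.
by case: (X t w) => [[x k]|].
Qed.

Definition mean_position t i j : R :=
  fine (\int[P 0 i]_(w in D t j) (xi t w)%:E)%E.

(** The position has exponential moments around the parameter 0, which allows to
    differentiate its Laplace transform there. *)
Lemma mean_positionP t i j : 0 <= t ->
  (\int[P 0 i]_(w in D t j) (xi t w)%:E = (mean_position t i j)%:E)%E /\
  is_derive (0 : R) 1 (fun p : R => M p t i j) (- mean_position t i j).
Proof.
move=> t0; have [p [pp p0]] := negative_parameter hp.
have p01 : p < 0 < (1 : R) by apply/andP; split.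
have mD : measurable (D t j) by exact: (measurable_type_event hMAP).
have mxi : measurable_fun (D t j) (fun w => - xi t w).
  by apply: measurable_funTS; apply: measurableT_comp => //; exact: (measurable_real_position hMAP).
have lap q : (underline_p c < q%:E)%E ->
    (\int[P 0 i]_(w in D t j) (expR (q * - xi t w))%:E = (M q t i j)%:E)%E.
  move=> pq; rewrite -(laplace_transform hchar)//.
  by apply: eq_integral => w _; rewrite mulrN.
have int q : (underline_p c < q%:E)%E ->
    (P 0 i).-integrable (D t j) (EFin \o (fun w => expR (q * - xi t w))).
  move=> pq; apply/integrableP; split.
    by apply/measurable_EFinP/measurable_expRM.
  under eq_integral do rewrite /= ger0_norm ?expR_ge0//.
  by rewrite lap// ltry.
have p1 : (underline_p c < 1%:E)%E by apply: lt_trans hp _; rewrite lte_fin.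
have := integrable_Y_mgf mD mxi p01 (int _ pp) (int _ p1).
under [X in EFin \o X]eq_fun do rewrite mul0r expR0 mulr1.
move=> iN.
have ix : (P 0 i).-integrable (D t j) (EFin \o xi t).
  have -> : EFin \o xi t = (fun w => (-1)%:E * (EFin \o (fun w => - xi t w)%R) w)%E.
    by apply/funext => w /=; rewrite -EFinM mulN1r opprK.
  exact: integrableZl.
split; first by rewrite /mean_position fineK//; exact: (integrable_fin_num mD ix).
have := is_derive_mgf mD mxi p01 (int _ pp) (int _ p1).
have -> : Rintegral (P 0 i) (D t j) (fun w => - xi t w * expR (0 * - xi t w)) =
    - mean_position t i j.
  transitivity (Rintegral (P 0 i) (D t j) (fun w => -1 * xi t w)).
    by apply: eq_Rintegral => w _; rewrite mul0r expR0 mulr1 mulN1r.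
  by rewrite RintegralZl// mulN1r.
apply: near_eq_is_derive; near=> q.
have pq : (underline_p c < q%:E)%E.
  by apply: (lt_trans pp); rewrite lte_fin; near: q; exact: lt_nbhsr.
by rewrite /Rintegral lap.
Unshelve. all: by end_near. Qed.

(** In [expmxNB_le] with [F = Phi c h] and [G = Phi c 0], dividing by [h] and
    letting [h] decrease to 0 bounds [mean_position t - t *: dPhi0] by
    [Dl * t * (expR (t * a) - 1)], which is [o(t)]. *)
Lemma mean_position_small i j :
  t^-1 * mean_position t i j @[t --> (0 : R)^'+] --> dPhi0 c i j.
Proof.
pose a := \sum_k \sum_l `|Phi c 0 k l| + 1.
pose dl (h : R) := \sum_k \sum_l `|Phi c h k l - Phi c 0 k l|.
(* [dl h] bounds the distance of [Phi c h] and [Phi c 0], [Dl] is the limit of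
   [dl h / h] *)
pose Dl := \sum_k \sum_l `|dPhi0 c k l|.
have dPhi k l := is_derive_Phi0 hchar hp k l.
have quot k l : h^-1 * (Phi c h k l - Phi c 0 k l) @[h --> 0^'+] --> dPhi0 c k l.
  exact: is_derive_cvg_right (dPhi k l).
have cdl : h^-1 * dl h @[h --> 0^'+] --> Dl.
  have : \sum_k \sum_l `|h^-1 * (Phi c h k l - Phi c 0 k l)| @[h --> 0^'+] --> Dl.
    by do 2 (apply: cvg_sum_real => ?); apply: cvg_norm; exact: quot.
  apply: cvg_trans; apply: near_eq_cvg; near=> h.
  have h0 : 0 < h by near: h; exact: nbhs_right_gt.
  rewrite /dl mulr_sumr; apply: eq_bigr => k _; rewrite mulr_sumr.
  by apply: eq_bigr => l _; rewrite normrM gtr0_norm// invr_gt0.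
have dl1 : \forall h \near (0 : R)^'+, dl h <= 1.
  have cd : dl h @[h --> (0 : R)^'+] --> 0.
    have : h * (h^-1 * dl h) @[h --> (0 : R)^'+] --> 0 * Dl.
      apply: cvgM => //; apply: cvg_at_right_filter; exact: cvg_id.
    rewrite mul0r; apply: cvg_trans; apply: near_eq_cvg; near=> h.
    by rewrite mulVKf// gt_eqF//; near: h; exact: nbhs_right_gt.
  by have /(_ _ ltr01) := cvgr_le _ cd 1.
have key (t : R) : 0 < t -> `|mean_position t i j - t * dPhi0 c i j| <=
    Dl * (t * (expR (t * a) - 1)).
  move=> t0; have [_ dM] := mean_positionP i j (ltW t0).
  have c1 : `|h^-1 * (M h t i j - M 0 t i j) +
       t * (h^-1 * (Phi c h i j - Phi c 0 i j))| @[h --> 0^'+] -->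
      `|- mean_position t i j + t * dPhi0 c i j|.
    apply: cvg_norm; apply: cvgD; first exact: is_derive_cvg_right dM.
    by apply: cvgM; [exact: cvg_cst|exact: quot].
  have c2 : h^-1 * dl h * (t * (expR (t * a) - 1)) @[h --> 0^'+] -->
      Dl * (t * (expR (t * a) - 1)).
    by apply: cvgM => //; exact: cvg_cst.
  rewrite distrC addrC; apply: (ler_cvg_to c1 c2); near=> h.
  have h0 : 0 < h by near: h; exact: nbhs_right_gt.
  have dlh : dl h <= 1 by near: h.
  have dl0 : 0 <= dl h by apply: sumr_ge0 => k _; apply: sumr_ge0.
  have a0 : 0 <= a by rewrite addr_ge0//; apply: sumr_ge0 => k _; apply: sumr_ge0.
  have row_le (F : 'I_K -> 'I_K -> R) k :
      \sum_l `|F k l| <= \sum_m \sum_l `|F m l|.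
    rewrite [leRHS](bigD1 k)//= lerDl.
    by apply: sumr_ge0 => m _; apply: sumr_ge0.
  have rowd k : \sum_l `|Phi c h k l - Phi c 0 k l| <= dl h.
    exact: (row_le (fun k l => Phi c h k l - Phi c 0 k l)).
  have row0 k : \sum_l `|Phi c 0 k l| <= \sum_m \sum_l `|Phi c 0 m l|.
    exact: (row_le (fun k l => Phi c 0 k l)).
  have row0' k : \sum_l `|Phi c 0 k l| <= a by rewrite (le_trans (row0 k))// lerDl.
  have rowh k : \sum_l `|Phi c h k l| <= a.
    apply: (@le_trans _ _ (\sum_l (`|Phi c 0 k l| + `|Phi c h k l - Phi c 0 k l|))).
      by apply: ler_sum => l _; rewrite (le_trans _ (ler_normD _ _))// addrC subrK.
    by rewrite big_split/=; apply: lerD => //; apply: le_trans dlh; exact: rowd.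
  have H := expmxNB_le a0 dl0 (ltW t0) rowh row0' rowd i j.
  have gen (x y z v r : R) : `|x - y + t * (z - v)| <= dl h * t * r ->
      `|h^-1 * (x - y) + t * (h^-1 * (z - v))| <= h^-1 * dl h * (t * r).
    rewrite (_ : h^-1 * (x - y) + t * (h^-1 * (z - v)) =
      h^-1 * (x - y + t * (z - v))); last by ring.
    move=> H'; rewrite normrM gtr0_norm ?invr_gt0// -[leRHS]mulrA.
    by rewrite ler_wpM2l ?invr_ge0 ?(ltW h0)// mulrA.
  exact: (gen _ _ _ _ _ H).
have ca : expR (t * a) - 1 @[t --> (0 : R)^'+] --> 0.
  apply: cvg_at_right_filter; rewrite -[X in _ --> X](subrr (1 : R)).
  apply: cvgB; last exact: cvg_cst.
  rewrite -[X in _ --> X]expR0; apply: continuous_cvg; first exact: continuous_expR.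
  by rewrite -[X in _ --> X](mul0r a); apply: cvgM; [exact: cvg_id|exact: cvg_cst].
have cD : Dl * (expR (t * a) - 1) @[t --> (0 : R)^'+] --> 0.
  by rewrite -[X in _ --> X](mulr0 Dl); apply: cvgM => //; exact: cvg_cst.
apply: (@squeeze_cvgr _ _ _ _ (fun t => dPhi0 c i j - Dl * (expR (t * a) - 1))
    (fun t => dPhi0 c i j + Dl * (expR (t * a) - 1))).
- near=> t; have t0 : 0 < t by near: t; exact: nbhs_right_gt.
  rewrite -ler_distl.
  have -> : t^-1 * mean_position t i j - dPhi0 c i j =
      t^-1 * (mean_position t i j - t * dPhi0 c i j).
    by rewrite mulrBr mulKf// gt_eqF.
  rewrite normrM gtr0_norm ?invr_gt0// ler_pdivrMl//.
  by apply: le_trans (key t t0) _; rewrite mulrCA.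
- by rewrite -[X in _ --> X]subr0; apply: cvgB => //; exact: cvg_cst.
- by rewrite -[X in _ --> X]addr0; apply: cvgD => //; exact: cvg_cst.
Unshelve. all: by end_near. Qed.

Lemma cvg_mean_position i j :
  ((t^-1)%:E * \int[P 0 i]_(w in [set w | type_at X t w = Some j]) position_at X t w)%E
    @[t --> 0^'+] --> (dPhi0 c i j)%:E.
Proof.
have : (t^-1 * mean_position t i j)%:E @[t --> (0 : R)^'+] --> (dPhi0 c i j)%:E.
  by apply: cvg_EFin; [near=> t|exact: mean_position_small].
apply: cvg_trans; apply: near_eq_cvg; near=> t.
have t0 : 0 <= t by apply: ltW; near: t; exact: nbhs_right_gt.
by rewrite integral_positionE (mean_positionP i j t0).1 EFinM.
Unshelve. all: by end_near. Qed.

(** [n.+1 * (expmx (- Phi c n.+1^-1) - expmx (- Phi c 0))] has two limits: minus the mean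
    position, and the derivative of the matrix exponential. *)
Lemma mean_position1 i j :
  mean_position 1 i j = Rintegral lebesgue_measure `[0, 1]%classic
    (fun s : R => (expmx (s *: rate c) *m dPhi0 c *m expmx ((1 - s) *: rate c)) i j).
Proof.
have NE (H : 'M[R]_K) k l : (- H) k l = - H k l by rewrite mxE.
have AE : rate c = - Phi c 0 by rewrite Phi0E// opprK.
have M1 q : M q 1 = expmx (- Phi c q) by rewrite /bernstein_semigroup scale1r.
have cQ k l : n.+1%:R * ((- Phi c n.+1%:R^-1) k l - (rate c) k l) @[n --> \oo] -->
    (- dPhi0 c) k l.
  have := is_derive_cvg_harmonic (is_deriveN (is_derive_Phi0 hchar hp k l)).
  rewrite NE [rate c k l](_ : _ = - Phi c 0 k l); last by rewrite AE NE.
  under [in X in _ -> X]eq_fun do rewrite NE.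
  by [].
have c1 := cvg_expmx_duhamel cQ (i := i) (j := j).
have [_ dM] := mean_positionP i j ler01.
have c2 : n.+1%:R * (expmx (- Phi c n.+1%:R^-1) i j - expmx (rate c) i j) @[n --> \oo] -->
    - mean_position 1 i j.
  have -> : (fun n => n.+1%:R * (expmx (- Phi c n.+1%:R^-1) i j - expmx (rate c) i j)) =
      (fun n => n.+1%:R * (M n.+1%:R^-1 1 i j - M 0 1 i j)).
    by apply/funext => n; rewrite M1 M1 AE.
  exact: (is_derive_cvg_harmonic dM).
have := cvg_unique _ c2 c1 => /(_ (@norm_hausdorff _ _)) E.
rewrite -[LHS]opprK E.
have iD : lebesgue_measure.-integrable `[0, 1]%classic
    (EFin \o (fun s : R => duhamel_integrand (rate c) (- dPhi0 c) (rate c) s i j)).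
  apply: continuous_compact_integrable; first exact: segment_compact.
  by apply: continuous_subspaceT; exact: continuous_duhamel_integrand.
rewrite -mulN1r -RintegralZl//.
apply: eq_Rintegral => s _; rewrite /duhamel_integrand mulmxN mulNmx.
by rewrite [X in -1 * X]mxE mulN1r opprK.
Qed.

End MeanPosition.

(** * Moments of negative integer order *)

Section NegativeIntegers.
Context (R : realType) (K : nat) (d : measure_display) (T : measurableType d)
  (P : R -> 'I_K -> probability T R) (X : R -> T -> state R K)
  (c : characteristics R K).
Hypotheses (hMAP : is_MAP P X) (hmono : nondecreasing_position P X)
  (hchar : has_characteristics P X c) (hkill : forall i, killing c i = 0)
  (hp : (underline_p c < 0)%E) (hirr : irreducible_rate (rate c))
  (hnonconst : ~ constant_position P X).

Local Notation mom := (mom P X).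
Local Notation N := (mom_vec P X).

(** Each step applies the recurrence with parameter [p = - n.+1%:R], which puts
    the factor [Phi c p / p] on the left. *)
Lemma mom_negS n : (underline_p c < (- n%:R)%:E)%E ->
  (forall i, mom (- n.+1%:R) i \is a fin_num) /\
  N (- n.+1%:R) = ((-1) ^+ n / n`!%:R) *:
    ((\prod_(0 <= a < n) Phi c (- n%:R + a%:R)) *m N (-1)).
Proof.
elim: n => [_|n IH pn].
  split; first by move=> i; exact: (mom_minus1_fin hMAP hmono hchar).
  by rewrite big_nil mul1mx expr0 fact0 invr1 mul1r scale1r.
have n0 : - n.+1%:R < 0 :> R by rewrite oppr_lt0.
have [|_ {}IH] := IH; first by apply: lt_le_trans pn _; rewrite lee_fin lerN2 ler_nat.
have nB : - n.+2%:R = - n.+1%:R - 1 :> R by rewrite -opprD -natr1.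
split=> [i|]; first by rewrite nB; exact: (mom_pred_fin hMAP hmono hchar).
have nz : - n.+1%:R != 0 :> R by rewrite lt_eqF.
have rec := mom_recurrence hMAP hmono hchar hkill hp hirr hnonconst pn n0.
have -> : N (- n.+2%:R) = (- n.+1%:R)^-1 *: (Phi c (- n.+1%:R) *m N (- n.+1%:R)).
  by rewrite rec scalerA mulVf// scale1r nB.
have prodE : \prod_(0 <= a < n.+1) Phi c (- n.+1%:R + a%:R) =
    Phi c (- n.+1%:R) *m \prod_(0 <= a < n) Phi c (- n%:R + a%:R).
  rewrite (big_nat_recl _ _ _ (leq0n n)) addr0; apply: (congr1 (mulmx _)).
  apply: eq_bigr => a _; apply: (congr1 (Phi c)).
  by rewrite -[n.+1%:R]natr1 -[a.+1%:R]natr1; ring.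
rewrite prodE -mulmxA.
transitivity ((- n.+1%:R)^-1 *: (Phi c (- n.+1%:R) *m (((-1) ^+ n / n`!%:R) *:
    ((\prod_(0 <= a < n) Phi c (- n%:R + a%:R)) *m N (-1))))).
  by congr (_ *: (mulmx _ _)); exact: IH.
rewrite -scalemxAr scalerA; congr (_ *: _).
rewrite factS natrM exprS invfM invrN; ring.
Qed.

End NegativeIntegers.

Unset Implicit Arguments.

Theorem proposition1p10 (R : realType) (K : nat)
    (d : measure_display) (T : measurableType d)
    (P : R -> 'I_K -> probability T R) (X : R -> T -> state R K)
    (c : characteristics R K)
    (hMAP : is_MAP P X)
    (hmono : nondecreasing_position P X)
    (hchar : has_characteristics P X c)
    (hirr : irreducible_rate (rate c))
    (hnonconst : ~ constant_position P X)
    (hkill : forall i, killing c i = 0)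
    (hp : (underline_p c < 0)%E) :
  let N := Nvec P X in
  let Phi'0 : 'M[R]_K := \matrix_(i, j) derive1 (fun p : R => Phi c p i j) 0 in
  let N'0 : 'cV[R]_K := \col_i derive1 (fun p : R => N p i 0) 0 in
  [/\ [/\ (forall i j, derivable (fun p : R => Phi c p i j) 0 1),
          (forall i, (\forall p \near (0 : R), moment P X p i \is a fin_num) /\
             derivable (fun p : R => N p i 0) 0 1),
          (forall i, moment P X (-1) i \is a fin_num) /\
          N (-1) = Phi'0 *m const_mx 1 - rate c *m N'0,
          (forall i j,
             ((t^-1)%:E *
              \int[P 0%R i]_(w in [set w | type_at X t w = Some j])
                 position_at X t w)%E @[t --> 0^'+] --> (Phi'0 i j)%:E) /\
          (forall i j,
             (\int[P 0%R i]_(w in [set w | type_at X 1%R w = Some j])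
                 position_at X 1%R w)%E =
             (Rintegral lebesgue_measure `[0, 1]%classic (fun s : R =>
                (expmx (s *: rate c) *m Phi'0 *m
                   expmx ((1 - s) *: rate c)) i j))%:E) &
          (forall i,
             \int[P 0%R i]_w lne (exp_functional X w) = (N'0 i 0%R)%:E)%E]
    & forall k : int, k < 0 -> (underline_p c - 1 < (k%:~R)%:E)%E ->
        (forall i, moment P X k%:~R i \is a fin_num) /\
        N k%:~R =
          ((-1) ^ (k + 1) / ((`|k|%N.-1)`!)%:R) *:
          ((\prod_(0 <= a < `|k|%N.-1) Phi c ((k + 1)%:~R + a%:R))
             *m N (-1))].
Proof.
move=> N Phi'0 N'0.
have adm : admissible c by case: hchar.
have NE p : N p = mom_vec P X p by exact: (Nvec_mom hMAP hmono hchar).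
have momE p i : moment P X p i = mom P X p i.
  by exact: (momentE hMAP hmono hchar).
have NiE i : (fun p => N p i 0) = (fun p => mom_vec P X p i 0).
  by apply/funext => p; rewrite NE.
have dN i : is_derive (0 : R) 1 (fun p => N p i 0)
    (Rintegral (P 0 i) setT (log_exp_functional X)).
  by rewrite NiE; exact: (is_derive_mom0 hMAP hmono hchar).
split; first split.
- exact: derivable_Phi0.
- move=> i; split; last by have [] := dN i.
  have := near0_mom_fin hMAP hmono hchar hkill hp hirr hnonconst i.
  by apply: filterS => p; rewrite momE.
- split=> [i|]; first by rewrite momE; exact: (mom_minus1_fin hMAP hmono hchar).
  have N'0E : N'0 = \col_i derive1 (fun p => mom_vec P X p i 0) 0.
    by apply/colP => i; rewrite [LHS]mxE [RHS]mxE NiE.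
  rewrite NE N'0E.
  exact: (mom_minus1 hMAP hmono hchar hkill hp hirr hnonconst).
- split=> i j; first exact: cvg_mean_position.
  rewrite (integral_positionE P X) (mean_positionP hMAP hchar hp i j ler01).1.
  by rewrite (mean_position1 hMAP hchar).
- move=> i; rewrite (integral_lne_exp_functional hMAP hmono hchar)//.
  rewrite (integral_log_exp_functional hMAP hmono hchar)// mxE derive1E.
  by have [_ ->] := dN i.
case=> // n _ pk.
have kE : (Negz n)%:~R = - n.+1%:R :> R by rewrite NegzE mulrNz.
have k1 : Negz n + 1 = - n%:Z by rewrite NegzE -[n.+1]addn1 PoszD; ring.
have k1E : (Negz n + 1)%:~R = - n%:R :> R by rewrite k1 mulrNz.
have pn : (underline_p c < (- n%:R)%:E)%E.
  move: pk; rewrite kE lteBlDr// -EFinD.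
  by rewrite (_ : - n.+1%:R + 1 = - n%:R)// -natr1; ring.
have [fin eqN] := mom_negS hMAP hmono hchar hkill hp hirr hnonconst pn.
split=> [i|]; first by rewrite momE kE.
have sgn : (-1 : R) ^ (Negz n + 1) = (-1) ^+ n by rewrite k1 -exprnN -exprVn invrN1.
rewrite NE NE sgn k1E kE.
exact: eqN.
Qed.
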